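(* Let $n \geq 1$. The set of strongly doubly reversible pairs in $\mathrm{PSp}(n,1)$ has Haar measure zero in $\mathrm{PSp}(n,1)\times \mathrm{PSp}(n,1)$.
   Context: $\mathbb{H}$ denotes Hamilton's quaternions and $\mathbb{H}^{n+1}$ is regarded as a right $\mathbb{H}$-vector space with the Hermitian form $\langle \mathbf z,\mathbf w\rangle = \bar w_{n+1} z_1 + \sum_{i=2}^{n} \bar w_i z_i + \bar w_1 z_{n+1}$. $\mathrm{Sp}(n,1)$ is the group of $(n+1)\times(n+1)$ quaternionic matrices preserving this form, and $\mathrm{PSp}(n,1)=\mathrm{Sp}(n,1)/\{\pm I\}$ (the isometry group of quaternionic hyperbolic $n$-space). For a group $G$, a pair $(g_1,g_2)\in G\times G$ is strongly doubly reversible if there is $g\in G$ with $g^2=1$ such that $g g_1 g^{-1}=g_1^{-1}$ and $g g_2 g^{-1}=g_2^{-1}$; equivalently, there are involutions $i_1,i_2,i_3\in G$ with $g_1=i_1i_2$, $g_2=i_1i_3$. *)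

(* Defs.v *)
From HB Require Import structures.
From mathcomp Require Import all_boot all_order all_algebra.
From mathcomp Require Import all_classical all_reals all_analysis.
Set Implicit Arguments. Unset Strict Implicit. Unset Printing Implicit Defensive.
Import Order.TTheory GRing.Theory Num.Theory.
Import numFieldNormedType.Exports.
Local Open Scope classical_set_scope.
Local Open Scope ring_scope.

Section Quaternions.
Variable R : realType.

Record quat := Quat { qre : R; qi : R; qj : R; qk : R }.

Definition q0 : quat := Quat 0 0 0 0.
Definition q1 : quat := Quat 1 0 0 0.
Definition qadd (p q : quat) : quat :=
  Quat (qre p + qre q) (qi p + qi q) (qj p + qj q) (qk p + qk q).
Definition qopp (p : quat) : quat := Quat (- qre p) (- qi p) (- qj p) (- qk p).
(* Hamilton product: i^2 = j^2 = k^2 = ijk = -1 *)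
Definition qmul (p q : quat) : quat :=
  Quat (qre p * qre q - qi p * qi q - qj p * qj q - qk p * qk q)
       (qre p * qi q + qi p * qre q + qj p * qk q - qk p * qj q)
       (qre p * qj q - qi p * qk q + qj p * qre q + qk p * qi q)
       (qre p * qk q + qi p * qj q - qj p * qi q + qk p * qre q).
Definition qconj (p : quat) : quat := Quat (qre p) (- qi p) (- qj p) (- qk p).

Definition qsum (m : nat) (F : 'I_m -> quat) : quat := \big[qadd/q0]_(k < m) F k.

(** Quaternionic (n+1)x(n+1) matrices, stored as the four real matrices of
    their components: A = A_re + A_i i + A_j j + A_k k.  The real-matrix
    storage only serves to give the space its standard (Euclidean) topology. *)
Definition qmat (n : nat) : Type :=
  (('M[R]_(n.+1) * 'M[R]_(n.+1)) * ('M[R]_(n.+1) * 'M[R]_(n.+1)))%type.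

Definition qentry n (A : qmat n) (i j : 'I_n.+1) : quat :=
  Quat (A.1.1 i j) (A.1.2 i j) (A.2.1 i j) (A.2.2 i j).

Definition qmat_of n (f : 'I_n.+1 -> 'I_n.+1 -> quat) : qmat n :=
  ((\matrix_(i, j) qre (f i j), \matrix_(i, j) qi (f i j)),
   (\matrix_(i, j) qj (f i j), \matrix_(i, j) qk (f i j))).

Definition qmatmul n (A B : qmat n) : qmat n :=
  qmat_of (fun i j => qsum (fun k => qmul (qentry A i k) (qentry B k j))).

Definition qmat1 n : qmat n :=
  qmat_of (fun i j => if i == j then q1 else q0).

Arguments qmat1 : clear implicits.
Definition qmatopp n (A : qmat n) : qmat n :=
  qmat_of (fun i j => qopp (qentry A i j)).

(** Vectors of H^{n+1} (right H-vector space); a matrix acts on the left. *)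
Definition qvec n := 'I_n.+1 -> quat.
Definition qact n (A : qmat n) (z : qvec n) : qvec n :=
  fun i => qsum (fun k => qmul (qentry A i k) (z k)).

(** The Hermitian form
    <z,w> = conj(w_{n+1}) z_1 + sum_{i=2}^{n} conj(w_i) z_i + conj(w_1) z_{n+1},
    with 1-based coordinates 1..n+1 corresponding to ordinals 0..n. *)
Definition hform n (z w : qvec n) : quat :=
  qadd (qmul (qconj (w ord_max)) (z ord0))
   (qadd (\big[qadd/q0]_(i < n.+1 | (0 < (i : nat))%N && ((i : nat) < n)%N)
            qmul (qconj (w i)) (z i))
         (qmul (qconj (w ord0)) (z ord_max))).

Definition Sp n : set (qmat n) :=
  [set A | forall z w : qvec n, hform (qact A z) (qact A w) = hform z w].

Arguments Sp : clear implicits.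
(** Equality in PSp(n,1) = Sp(n,1)/{+-I} of the classes of A and B. *)
Definition psp_eq n (A B : qmat n) : Prop := A = B \/ A = qmatopp B.

(** Strong double reversibility of the pair ([A],[B]) in PSp(n,1), for
    representatives A, B in Sp(n,1): there is [g] in PSp(n,1) with
    [g]^2 = 1, [g][A][g]^{-1} = [A]^{-1}, [g][B][g]^{-1} = [B]^{-1}.
    Inverses are given explicitly by their defining equations. *)
Definition psp_strongly_doubly_reversible n (A B : qmat n) : Prop :=
  exists g gi Ai Bi : qmat n,
    [/\ Sp n g, Sp n gi, Sp n Ai & Sp n Bi] /\
    [/\ qmatmul g gi = qmat1 n, qmatmul A Ai = qmat1 n & qmatmul B Bi = qmat1 n] /\
    [/\ psp_eq (qmatmul g g) (qmat1 n),
        psp_eq (qmatmul (qmatmul g A) gi) Ai &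
        psp_eq (qmatmul (qmatmul g B) gi) Bi].

Definition qpair n : Type := (qmat n * qmat n)%type.
Definition borel_qpair n := g_sigma_algebraType (@open (qpair n)).

Definition SpSp n : set (qpair n) := [set p | Sp n p.1 /\ Sp n p.2].
Arguments SpSp : clear implicits.
Definition lmul2 n (g p : qpair n) : qpair n :=
  (qmatmul g.1 p.1, qmatmul g.2 p.2).

(** Left Haar measures of the (second countable, locally compact) group
    Sp(n,1) x Sp(n,1), viewed as Borel measures on the ambient space that are
    concentrated on the group, finite on compact sets and left-invariant.
    By uniqueness of Haar measure these are exactly the nonnegative multiples
    of Haar measure (extended by zero). *)
Definition haar_like n (mu : {measure set (borel_qpair n) -> \bar R}) : Prop :=
  [/\ mu (~` SpSp n) = 0%E,
      (forall K : set (qpair n), compact K -> (mu K < +oo)%E) &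
      (forall g : qpair n, SpSp n g ->
         forall X : set (borel_qpair n), measurable X -> X `<=` SpSp n ->
           mu (lmul2 g @` X) = mu X)].

Definition haar_null n (S : set (qpair n)) : Prop :=
  forall mu : {measure set (borel_qpair n) -> \bar R},
    haar_like mu -> mu.-negligible (S : set (borel_qpair n)).

End Quaternions.

(* Main.v *)
Require Import Defs.
From HB Require Import structures.
From mathcomp Require Import all_boot all_order all_algebra.
From mathcomp Require Import all_classical all_reals all_analysis.
From mathcomp Require Import measurable_realfun ring lra.
Set Implicit Arguments. Unset Strict Implicit. Unset Printing Implicit Defensive.
Import Order.TTheory GRing.Theory Num.Theory.
Import numFieldNormedType.Exports.
Local Open Scope classical_set_scope.
Local Open Scope ring_scope.

(** Put tau = Re tr and f(A, B) = tau(A^3 B^3 A B) - tau(A^3 B A B^3).  If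
    g A g^-1 = +-A^-1 and g B g^-1 = +-B^-1 then f(A, B) = 0: the signs cancel
    because A and B occur an even number of times, an element X of Sp(n,1)
    satisfies tau(X^-1) = tau(X), and the two cyclic words are reversals of each
    other.  So it is enough that the zero set of the polynomial f is Haar null.

    Let gamma(t) be a one-parameter group of pairs of unipotents; it is polynomial
    in t.  If f vanishes at x but not at gamma(1) x, then t |-> f(gamma(t) x) is a
    nonzero polynomial of bounded degree d, so the translates by gamma(1/k) of a
    bounded piece of the set of all such x cover each point at most d times while
    staying in one compact set; by invariance that piece is null.  Iterating along
    products h of unipotents, the part of {f = 0} where f(h x) <> 0 is null, and
    by compactness finitely many h suffice on bounded sets, provided that every x
    is moved out of {f = 0} by some h.

    For the latter, Gaussian elimination with unipotents brings each component of x
    to an element fixing e_0 and e_n, i.e. to a block sum of the identity of the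
    hyperbolic plane <e_0, e_n> and some M.  Multiplying the plane blocks by
    U(i) L(j) and U(j) L(k), where U and L are the upper and lower unipotents of
    Sp(1,1), changes f by 16. *)

(** * Quaternions *)

Section QuatRing.
Variable R : realType.
Local Notation H := (quat R).

Definition quat_tuple (q : H) := (qre q, qi q, qj q, qk q).
Definition tuple_quat (t : R * R * R * R) : H :=
  let: (a, b, c, d) := t in Quat a b c d.
Lemma quat_tupleK : cancel quat_tuple tuple_quat. Proof. by case. Qed.
HB.instance Definition _ := Choice.copy H (can_type quat_tupleK).

Lemma quatP (p q : H) :
  qre p = qre q -> qi p = qi q -> qj p = qj q -> qk p = qk q -> p = q.
Proof. by case: p q => [????] [????] /= -> -> -> ->. Qed.

Fact qaddA : associative (@qadd R).
Proof. by move=> p q r; apply: quatP => /=; ring. Qed.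
Fact qaddC : commutative (@qadd R).
Proof. by move=> p q; apply: quatP => /=; ring. Qed.
Fact qadd0 : left_id (q0 R) (@qadd R).
Proof. by move=> p; apply: quatP => /=; ring. Qed.
Fact qaddN : left_inverse (q0 R) (@qopp R) (@qadd R).
Proof. by move=> p; apply: quatP => /=; ring. Qed.
HB.instance Definition _ := GRing.isZmodule.Build H qaddA qaddC qadd0 qaddN.

Fact qmulA : associative (@qmul R).
Proof. by move=> p q r; apply: quatP => /=; ring. Qed.
Fact qmul1 : left_id (q1 R) (@qmul R).
Proof. by move=> p; apply: quatP => /=; ring. Qed.
Fact qmulr1 : right_id (q1 R) (@qmul R).
Proof. by move=> p; apply: quatP => /=; ring. Qed.
Fact qmulDl : left_distributive (@qmul R) (@qadd R).
Proof. by move=> p q r; apply: quatP => /=; ring. Qed.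
Fact qmulDr : right_distributive (@qmul R) (@qadd R).
Proof. by move=> p q r; apply: quatP => /=; ring. Qed.
Fact q1_neq0 : q1 R != q0 R.
Proof. by apply/eqP => -[] /eqP; rewrite oner_eq0. Qed.
HB.instance Definition _ :=
  GRing.Zmodule_isNzRing.Build H qmulA qmul1 qmulr1 qmulDl qmulDr q1_neq0.

Lemma qre_mulC (p q : H) : qre (p * q) = qre (q * p).
Proof. by move: p q => [????] [????] /=; ring. Qed.
Lemma qre_sum I (r : seq I) P (F : I -> H) :
  qre (\sum_(i <- r | P i) F i) = \sum_(i <- r | P i) qre (F i).
Proof. by apply: (big_morph (@qre R)). Qed.

Lemma qconjM (p q : H) : qconj (p * q) = qconj q * qconj p.
Proof. by apply: quatP => /=; ring. Qed.
Lemma qconjD (p q : H) : qconj (p + q) = qconj p + qconj q.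
Proof. by apply: quatP => /=; ring. Qed.
Lemma qconjN (p : H) : qconj (- p) = - qconj p.
Proof. by apply: quatP => /=; ring. Qed.
Lemma qconjK : involutive (@qconj R).
Proof. by move=> p; apply: quatP => /=; ring. Qed.
Lemma qconj0 : qconj (0 : H) = 0.
Proof. by apply: quatP => /=; ring. Qed.
Lemma qconj1 : qconj (1 : H) = 1.
Proof. by apply: quatP => /=; ring. Qed.
Lemma qconj_sum I (r : seq I) P (F : I -> H) :
  qconj (\sum_(i <- r | P i) F i) = \sum_(i <- r | P i) qconj (F i).
Proof. by apply: (big_morph _ qconjD qconj0). Qed.

Definition qreal (r : R) : H := Quat r 0 0 0.

Lemma qreal_comm r (q : H) : qreal r * q = q * qreal r.
Proof. by apply: quatP => /=; ring. Qed.
Lemma qrealD r s : qreal (r + s) = qreal r + qreal s.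
Proof. by apply: quatP => /=; ring. Qed.
Lemma qrealN r : qreal (- r) = - qreal r.
Proof. by apply: quatP => /=; ring. Qed.
Lemma qrealM r s : qreal (r * s) = qreal r * qreal s.
Proof. by apply: quatP => /=; ring. Qed.
Lemma qreal0 : qreal 0 = 0. Proof. by []. Qed.
Lemma qreal1 : qreal 1 = 1. Proof. by []. Qed.
Lemma qconj_real r : qconj (qreal r) = qreal r.
Proof. by apply: quatP => /=; ring. Qed.

Definition qnorm2 (q : H) : R := qre q ^+ 2 + qi q ^+ 2 + qj q ^+ 2 + qk q ^+ 2.

Lemma qconj_mul (q : H) : qconj q * q = qreal (qnorm2 q).
Proof. by rewrite /qnorm2; apply: quatP => /=; ring. Qed.
Lemma qmul_conj (q : H) : q * qconj q = qreal (qnorm2 q).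
Proof. by rewrite /qnorm2; apply: quatP => /=; ring. Qed.

Lemma qnorm2_ge0 q : 0 <= qnorm2 q.
Proof. by rewrite /qnorm2 !addr_ge0 // sqr_ge0. Qed.

Lemma qnorm2_eq0 q : (qnorm2 q == 0) = (q == 0).
Proof.
apply/eqP/eqP => [|->]; last by rewrite /qnorm2 /=; ring.
case: q => a b c d; rewrite /qnorm2 /= => /eqP.
rewrite !paddr_eq0 ?addr_ge0 ?sqr_ge0 // !sqrf_eq0.
by move=> /andP[/andP[/andP[/eqP-> /eqP->] /eqP->] /eqP->].
Qed.

Definition qinv (q : H) : H := qreal (qnorm2 q)^-1 * qconj q.

Lemma qmulV q : q != 0 -> q * qinv q = 1.
Proof.
rewrite -qnorm2_eq0 => q0; rewrite /qinv mulrA -qreal_comm -mulrA qmul_conj.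
by rewrite -qrealM mulVf.
Qed.

Lemma qmulVq q : q != 0 -> qinv q * q = 1.
Proof.
rewrite -qnorm2_eq0 => q0; rewrite /qinv -mulrA qconj_mul.
by rewrite -qrealM mulVf.
Qed.

(** If [u] is nonzero imaginary and [u * q] is imaginary, then [v = u^-1 q] is a real multiple of
    [u * q], hence imaginary. It suffices to take [u] orthogonal to the imaginary part of [q]. *)
Lemma qimag_prod (q : H) : exists u v : H,
  [/\ qconj u = - u, qconj v = - v & u * v = q].
Proof.
have key (u : H) : u != 0 -> qconj u = - u -> qre (u * q) = 0 ->
    exists u v : H, [/\ qconj u = - u, qconj v = - v & u * v = q].
  move=> u0 uI re0; exists u, (qinv u * q); split => //; last first.
    by rewrite mulrA qmulV // mul1r.
  have -> : qinv u * q = - (qreal (qnorm2 u)^-1 * (u * q)).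
    by rewrite /qinv uI mulrN mulNr mulrA.
  rewrite qconjN qconjM qconj_real -qreal_comm; congr (- _).
  rewrite -mulrN; congr (_ * _).
  by move: re0; case: (u * q) => a b c d /= ->; apply: quatP => /=; ring.
(* The orthogonal [u] is [i] when the i-component of [q] vanishes, and otherwise [qj q] times [i]
   minus [qi q] times [j]. *)
have [/eqP x0|x0] := boolP (qi q == 0).
  apply: (key (Quat 0 1 0 0)).
  - by apply/eqP => -[] /eqP; rewrite oner_eq0.
  - by apply: quatP => /=; ring.
  - by rewrite /= x0; ring.
apply: (key (Quat 0 (qj q) (- qi q) 0)).
- by apply/eqP => -[_ /eqP]; rewrite oppr_eq0 (negPf x0).
- by apply: quatP => /=; ring.
- by move=> /=; ring.
Qed.

End QuatRing.

(** * Quaternionic matrices and unipotents *)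

Definition adjmx (R : realType) m p (A : 'M[quat R]_(m, p)) : 'M[quat R]_(p, m) :=
  \matrix_(i, j) qconj (A j i).
Notation "A ^h" := (adjmx A) (at level 8, format "A ^h") : ring_scope.

Section QuatMatrix.
Variable R : realType.
Local Notation H := (quat R).

Lemma adjmxM m p r (A : 'M[H]_(m, p)) (B : 'M[H]_(p, r)) :
  (A *m B)^h = B^h *m A^h.
Proof.
apply/matrixP => i j; rewrite !mxE qconj_sum.
by apply: eq_bigr => k _; rewrite !mxE qconjM.
Qed.

Lemma adjmxK m p (A : 'M[H]_(m, p)) : A^h^h = A.
Proof. by apply/matrixP => i j; rewrite !mxE qconjK. Qed.

Lemma adjmxD m p (A B : 'M[H]_(m, p)) : (A + B)^h = A^h + B^h.
Proof. by apply/matrixP => i j; rewrite !mxE qconjD. Qed.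

Lemma adjmxN m p (A : 'M[H]_(m, p)) : (- A)^h = - A^h.
Proof. by apply/matrixP => i j; rewrite !mxE qconjN. Qed.

Lemma adjmx1 m : (1%:M : 'M[H]_m)^h = 1%:M.
Proof.
by apply/matrixP => i j; rewrite !mxE eq_sym; case: eqP; rewrite ?qconj1 ?qconj0.
Qed.

Lemma adjmx_scalar (u : H) m : (u%:M : 'M[H]_m)^h = (qconj u)%:M.
Proof.
by apply/matrixP => i j; rewrite !mxE eq_sym; case: eqP; rewrite ?qconj0.
Qed.

Lemma adjmx_delta m p (i : 'I_m) (j : 'I_p) :
  (delta_mx i j : 'M[H]_(m, p))^h = delta_mx j i.
Proof.
apply/matrixP => k l; rewrite !mxE andbC.
by case: (_ && _); rewrite ?qconj1 ?qconj0.
Qed.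

(** Real scalars are central in the quaternions, so they pass a left factor; a general quaternion
    does not. *)
Lemma scale_realAr m p r (a : R) (A : 'M[H]_(m, p)) (B : 'M[H]_(p, r)) :
  A *m (qreal a *: B) = qreal a *: (A *m B).
Proof.
apply/matrixP => i j; rewrite !mxE big_distrr.
by apply: eq_bigr => k _; rewrite !mxE /= !mulrA qreal_comm.
Qed.

Lemma adjmx_scale_real m p (a : R) (A : 'M[H]_(m, p)) :
  (qreal a *: A)^h = qreal a *: A^h.
Proof.
by apply/matrixP => i j; rewrite !mxE qconjM qconj_real qreal_comm.
Qed.

(** Over the noncommutative quaternions the trace is not cyclic, but its real part is, because
    [Re(pq) = Re(qp)]. *)
Lemma qre_mxtraceC m p (A : 'M[H]_(m, p)) (B : 'M[H]_(p, m)) :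
  qre (\tr (A *m B)) = qre (\tr (B *m A)).
Proof.
rewrite /mxtrace !qre_sum.
under eq_bigr do rewrite mxE qre_sum.
under [RHS]eq_bigr do rewrite mxE qre_sum.
rewrite exchange_big; apply: eq_bigr => i _; apply: eq_bigr => j _.
exact: qre_mulC.
Qed.

Lemma qre_mxtrace_adj m (A : 'M[H]_m) : qre (\tr A^h) = qre (\tr A).
Proof. by rewrite /mxtrace !qre_sum; apply: eq_bigr => i _; rewrite mxE. Qed.

End QuatMatrix.

Section Unipotents.
Variables (R : realType) (n : nat).
Hypothesis n_gt0 : (0 < n)%N.
Local Notation H := (quat R).
Local Notation M := 'M[H]_(n.+1).

(** The form pairs coordinate [i] with coordinate [hdual i], so with [J = gram] it reads
    [<z, w> = w^h J z]. *)
Definition hdual (i : 'I_n.+1) : 'I_n.+1 :=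
  if i == ord0 then ord_max else if i == ord_max then ord0 else i.

Lemma ord_max_neq0 : (ord_max == ord0 :> 'I_n.+1) = false.
Proof. by apply/negbTE; rewrite -val_eqE /= -lt0n. Qed.

Lemma hdualK : involutive hdual.
Proof.
move=> i; rewrite /hdual; have [->|i0] := eqVneq i ord0.
  by rewrite ord_max_neq0 eqxx.
have [->|iM] := eqVneq i ord_max; first by rewrite eqxx.
by rewrite (negPf i0) (negPf iM).
Qed.

Definition gram : M := \matrix_(i, j) (hdual i == j)%:R.
Local Notation J := gram.

Lemma gramE p (A : 'M[H]_(n.+1, p)) i j : (J *m A) i j = A (hdual i) j.
Proof.
rewrite mxE (bigD1 (hdual i)) //= mxE eqxx mul1r big1 ?addr0 // => k ki.
by rewrite mxE eq_sym (negPf ki) mul0r.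
Qed.

Lemma gramK : J *m J = 1%:M.
Proof. by apply/matrixP => i j; rewrite gramE !mxE hdualK. Qed.

Lemma gram_adj : J^h = J.
Proof.
apply/matrixP => i j; rewrite !mxE -(inj_eq (can_inj hdualK)) hdualK eq_sym.
by case: eqP; rewrite ?qconj0 ?qconj1.
Qed.

(** Matrix form of membership in Sp(n,1); [SpP] proves the equivalence. *)
Definition isom (A : M) := A^h *m J *m A = J.

Lemma isom1 : isom 1%:M.
Proof. by rewrite /isom adjmx1 mul1mx mulmx1. Qed.

Lemma isomM A B : isom A -> isom B -> isom (A *m B).
Proof.
rewrite /isom => hA hB.
by rewrite adjmxM -!mulmxA (mulmxA J) (mulmxA _ _ B) (mulmxA A^h) hA mulmxA.
Qed.

(** The second condition places [K] in the Lie algebra of Sp(n,1). The first stops the exponential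
    series at degree 2, so the one-parameter group is polynomial in time. *)
Definition skew_nil (K : M) := K *m K *m K = 0 /\ K^h *m J = - (J *m K).

(* exp (t K), for skew_nil K *)
Definition uexp (K : M) (t : R) : M :=
  1%:M + qreal t *: K + qreal (t ^+ 2 / 2) *: (K *m K).

Lemma uexp0 K : uexp K 0 = 1%:M.
Proof. by rewrite /uexp expr0n mul0r qreal0 !scale0r !addr0. Qed.

Lemma uexpD K s t : skew_nil K -> uexp K s *m uexp K t = uexp K (s + t).
Proof.
move=> [K3 _]; rewrite /uexp !mulmxDl !mulmxDr !mul1mx !mulmx1.
rewrite -!scalemxAl !scale_realAr !mulmxA K3 mul0mx !scaler0 !addr0.
rewrite !scalerA -!qrealM -!addrA; congr (_ + _).
rewrite [X in _ = X + _](_ : _ = qreal s *: K + qreal t *: K); last first.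
  by rewrite qrealD scalerDl.
rewrite [X in _ = _ + X](_ : _ = qreal (t ^+ 2 / 2) *: (K *m K) +
   (qreal (s * t) *: (K *m K) + qreal (s ^+ 2 / 2) *: (K *m K))); last first.
  by rewrite -!scalerDl -!qrealD; congr (qreal _ *: _); field.
rewrite (addrCA (qreal (t ^+ 2 / 2) *: _)) addrC -!addrA; congr (_ + _).
by rewrite [RHS]addrC -!addrA.
Qed.

(** Skewness gives [exp(tK)^h J = J exp(-tK)]. *)
Lemma uexp_isom K t : skew_nil K -> isom (uexp K t).
Proof.
move=> sK; have [_ hK] := sK.
have e : (uexp K t)^h *m J = J *m uexp K (- t).
  rewrite /uexp !adjmxD !adjmx_scale_real adjmx1 adjmxM !mulmxDl !mulmxDr.
  rewrite -!scalemxAl !scale_realAr mul1mx mulmx1 -(mulmxA K^h) hK sqrrN.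
  by rewrite mulmxN (mulmxA K^h) hK mulNmx opprK mulmxA scalerN -scaleNr qrealN.
by rewrite /isom e -mulmxA uexpD // addNr uexp0 mulmx1.
Qed.

(** Finite products of exponentials. Time 1 loses nothing, as a real factor can be absorbed into
    [K]. *)
Inductive unip : M -> Prop :=
| unip1 : unip 1%:M
| unipS K h : skew_nil K -> unip h -> unip (uexp K 1 *m h).

Lemma unip_uexp K : skew_nil K -> unip (uexp K 1).
Proof. by move=> sK; rewrite -[uexp K 1]mulmx1; apply: unipS => //; exact: unip1. Qed.

Lemma unipM g h : unip g -> unip h -> unip (g *m h).
Proof.
elim=> [|K g' sK ug IH] uh; first by rewrite mul1mx.
by rewrite -mulmxA; apply: unipS => //; exact: IH.
Qed.

Lemma unip_isom g : unip g -> isom g.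
Proof.
by elim=> [|K h sK _ IH]; [exact: isom1 | exact: isomM (uexp_isom _ sK) IH].
Qed.

(** * Transvections and Eichler transformations *)

Section Transvections.
Variable a : 'cV[H]_(n.+1).
Hypothesis a_null : a^h *m J *m a = 0.

(** The map [x |-> (J a) u <x, J a>]: an infinitesimal transvection along the isotropic vector
    [J a]. *)
Definition transv (u : H) : M := J *m a *m u%:M *m a^h.

Lemma transv2 u : transv u *m transv u = 0.
Proof.
have e p (X : 'M[H]_(1, p)) : a^h *m (J *m (a *m X)) = 0.
  by rewrite !mulmxA a_null mul0mx.
by rewrite /transv -!mulmxA e !mulmx0.
Qed.

Lemma transv_skew u : qconj u = - u -> skew_nil (transv u).
Proof.
move=> uI; split; first by rewrite transv2 mul0mx.
rewrite /transv !adjmxM adjmx_scalar adjmxK gram_adj uI.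
rewrite -!mulmxA gramK mulmx1 (mulmxA J J) gramK mul1mx.
by rewrite raddfN /= mulNmx mulmxN.
Qed.

Lemma uexp_transv u : uexp (transv u) 1 = 1%:M + transv u.
Proof. by rewrite /uexp transv2 scaler0 addr0 qreal1 scale1r. Qed.

Variable v : 'cV[H]_(n.+1).
Hypotheses (a_v : a^h *m v = 0) (Jv : J *m v = v) (v_a : v^h *m J *m a = 0).

(** The infinitesimal Eichler transformation [x |-> v <x, J a> - (J a) <x, v>], for [v] orthogonal
    to [a] and [J a]. Its square has image in the line of [J a], which it kills. *)
Definition eichler : M := v *m a^h - J *m a *m v^h.

Lemma eichler2 : eichler *m eichler = - (J *m a *m (v^h *m v) *m a^h).
Proof.
rewrite /eichler mulmxBl !mulmxBr !mulmxA.
rewrite -(mulmxA v a^h v) a_v mulmx0 mul0mx sub0r.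
rewrite -(mulmxA v) -(mulmxA v _ a) a_null mulmx0 mul0mx oppr0 sub0r.
rewrite -(mulmxA _ v^h J) -(mulmxA _ _ a) v_a mulmx0 mul0mx subr0.
by rewrite -!mulmxA.
Qed.

Lemma eichler_skew : skew_nil eichler.
Proof.
split.
  rewrite eichler2 /eichler mulNmx -!mulmxA mulmxBr !mulmxA.
  rewrite a_v a_null !mul0mx subrr -!mulmxA !(mulmx0, oppr0) //.
rewrite /eichler adjmxD adjmxN !adjmxM !adjmxK gram_adj mulmxBl mulmxBr opprB.
rewrite -!mulmxA gramK mulmx1 (mulmxA J J) gramK mul1mx (mulmxA J v) Jv.
by congr (_ *m _ - _); rewrite -[in RHS]Jv adjmxM gram_adj.
Qed.

End Transvections.
End Unipotents.

(** * Gaussian elimination by unipotents *)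

Section Elimination.
Variables (R : realType) (n : nat).
Hypothesis n_gt0 : (0 < n)%N.
Local Notation H := (quat R).
Local Notation M := 'M[H]_(n.+1).
Local Notation V := 'cV[H]_(n.+1).
Local Notation J := (gram R n).
Local Notation hd := (@hdual n).
Local Notation nmax0 := (ord_max_neq0 n_gt0).

Lemma qconj_imag (u : H) : qre u = 0 -> qconj u = - u.
Proof. by move=> u0; apply: quatP => //=; rewrite u0 oppr0. Qed.

Lemma qre_imag (u : H) : qconj u = - u -> qre u = 0.
Proof. by move=> /(congr1 (@qre R)) /= e; lra. Qed.

Definition basev (o : 'I_n.+1) : V := delta_mx o 0.
Definition isotropic (x : V) := x^h *m J *m x = 0.

Lemma basev_adjM p o (X : 'M[H]_(n.+1, p)) : (basev o)^h *m X = row o X.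
Proof. by rewrite /basev adjmx_delta rowE. Qed.

Lemma gram_basev o : J *m basev o = basev (hd o).
Proof.
apply/matrixP => i j; rewrite gramE /basev !mxE.
by rewrite -(inj_eq (can_inj (hdualK n_gt0))) hdualK.
Qed.

Lemma isotropicE (x : V) :
  (x^h *m J *m x) 0 0 = \sum_i qconj (x i 0) * x (hd i) 0.
Proof.
by rewrite -mulmxA mxE; apply: eq_bigr => i _; rewrite gramE mxE.
Qed.

Lemma isotropicM (h : M) x : isom h -> isotropic x -> isotropic (h *m x).
Proof.
rewrite /isom /isotropic => hh hx.
by rewrite adjmxM -!mulmxA (mulmxA J) (mulmxA h^h) (mulmxA h^h J) hh mulmxA.
Qed.

(** The two coordinates of the hyperbolic plane. The elimination steps take either of them as pivot
    [o], so that they serve for the first and the last column alike. *)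
Definition endpt (o : 'I_n.+1) := (o == ord0) || (o == ord_max).

Lemma hdual0 : hd ord0 = ord_max. Proof. by rewrite /hdual eqxx. Qed.
Lemma hdual_max : hd ord_max = ord0. Proof. by rewrite /hdual nmax0 eqxx. Qed.
Lemma hdual_mid i : ~~ endpt i -> hd i = i.
Proof. by rewrite negb_or /hdual => /andP[/negPf-> /negPf->]. Qed.
Lemma endpt_hdual o : endpt o -> endpt (hd o).
Proof. by move=> /orP[]/eqP->; rewrite ?hdual0 ?hdual_max /endpt eqxx ?orbT. Qed.
Lemma hdual_neq o : endpt o -> (hd o == o) = false.
Proof.
by move=> /orP[]/eqP->; rewrite ?hdual0 ?hdual_max ?nmax0 // eq_sym nmax0.
Qed.
Lemma neq_hdual o : endpt o -> (o == hd o) = false.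
Proof. by rewrite eq_sym; exact: hdual_neq. Qed.
Lemma endptE o i : endpt o -> endpt i = (i == o) || (i == hd o).
Proof.
by move=> /orP[]/eqP->; rewrite ?hdual0 ?hdual_max // /endpt orbC.
Qed.

Lemma isotropic_basev o : endpt o -> isotropic (basev o).
Proof.
move=> eo; rewrite /isotropic -mulmxA gram_basev basev_adjM.
by apply/matrixP => i j; rewrite !mxE neq_hdual.
Qed.

Lemma transv_act o u (x : V) i : endpt o ->
  (uexp (transv (basev o) u) 1 *m x) i 0 =
  x i 0 + (if i == hd o then u * x o 0 else 0).
Proof.
move=> eo; rewrite uexp_transv ?mulmxDl ?mul1mx; last exact: isotropic_basev.
rewrite mxE /transv -!mulmxA basev_adjM mulmxA gram_basev; congr (_ + _).
rewrite mxE big_ord1 !mxE andbT big_ord1 !mxE eqxx mulr1n.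
by case: eqP => _; rewrite ?mul1r ?mul0r.
Qed.

Lemma unip_transv o u : endpt o -> qre u = 0 ->
  unip (uexp (transv (basev o) u) 1).
Proof.
move=> eo u0; apply: unip_uexp; apply: transv_skew => //.
  exact: isotropic_basev.
exact: qconj_imag.
Qed.

Lemma transv_fix o u : endpt o ->
  uexp (transv (basev o) u) 1 *m basev (hd o) = basev (hd o).
Proof.
move=> eo; apply/matrixP => i j; rewrite (ord1 j) transv_act //.
by rewrite [X in u * X]mxE neq_hdual // mulr0 if_same addr0.
Qed.

(** An Eichler transformation adds [v_i x_o] to each middle coordinate [i], so [v_i = - x_i x_o^-1]
    clears it. It fixes [basev (hd o)], which keeps an already normalised column in place. *)
Lemma kill_mid o (x : V) : endpt o -> x o 0 != 0 -> exists h : M,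
  [/\ unip h, (h *m x) o 0 = x o 0,
      forall i, ~~ endpt i -> (h *m x) i 0 = 0 &
      h *m basev (hd o) = basev (hd o)].
Proof.
move=> eo xo; pose v : V := \col_i (if endpt i then 0 else - x i 0 * qinv (x o 0)).
have av : (basev o)^h *m v = 0.
  by rewrite basev_adjM; apply/matrixP => i j; rewrite !mxE eo.
have Jv : J *m v = v.
  apply/matrixP => i j; rewrite gramE !mxE.
  have [ei|ei] := boolP (endpt i); first by rewrite endpt_hdual.
  by rewrite hdual_mid // (negPf ei).
have va : v^h *m J *m basev o = 0.
  rewrite -mulmxA gram_basev; apply/matrixP => i j; rewrite !mxE.
  apply: big1 => k _; rewrite !mxE; case: eqP => [->|_]; last by rewrite mulr0.
  by rewrite endpt_hdual // qconj0 mul0r.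
have a0 := isotropic_basev eo.
set K := eichler (basev o) v.
have Kx (y : V) i : (K *m y) i 0 = v i 0 * y o 0 - (i == hd o)%:R * (v^h *m y) 0 0.
  rewrite /K /eichler mulmxBl -!mulmxA basev_adjM (mulmxA J) gram_basev.
  by rewrite !mxE !big_ord1 !mxE andbT.
have sK : skew_nil K by exact: eichler_skew.
clearbody K.
have vo : v o 0 = 0 by rewrite mxE eo.
have hE (y : V) i : i != hd o -> (uexp K 1 *m y) i 0 = y i 0 + v i 0 * y o 0.
  move=> io; rewrite /uexp !mulmxDl mul1mx -!scalemxAl -mulmxA.
  rewrite qreal1 scale1r mxE [X in X + _]mxE [X in _ + X]mxE !Kx (negPf io).
  by rewrite vo neq_hdual // !mul0r !subr0 !mulr0 addr0.
exists (uexp K 1); split.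
- exact: unip_uexp.
- by rewrite hE ?vo ?mul0r ?addr0 // neq_hdual.
- move=> i ei; rewrite hE; last first.
    by apply: contra ei => /eqP ->; exact: endpt_hdual.
  by rewrite mxE (negPf ei) -mulrA qmulVq // mulr1 addrN.
- have Kf : K *m basev (hd o) = 0.
    apply/matrixP => i j; rewrite (ord1 j) Kx.
    rewrite [basev _ o _]mxE neq_hdual // mulr0 sub0r.
    have -> : v^h *m basev (hd o) = 0 by rewrite -gram_basev mulmxA.
    by rewrite !mxE mulr0 oppr0.
  by rewrite /uexp !mulmxDl -!scalemxAl -mulmxA Kf mulmx0 !scaler0 mul1mx !addr0.
Qed.

(** A transvection adds [u x_o] to the coordinate [hd o], so [u = - x_(hd o) x_o^-1] clears it.
    Isotropy makes [u] imaginary: with zero middle coordinates it forces the real part of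
    [qconj x_o * x_(hd o)] to vanish. *)
Lemma kill_end o (x : V) : endpt o -> x o 0 != 0 -> isotropic x ->
  (forall i, ~~ endpt i -> x i 0 = 0) -> exists h : M,
  [/\ unip h, h *m x = basev o *m (x o 0)%:M &
      h *m basev (hd o) = basev (hd o)].
Proof.
move=> eo xo x0 xm; pose u := - x (hd o) 0 * qinv (x o 0).
have u0 : qre u = 0.
  have : qre ((x^h *m J *m x) 0 0) = 0 by rewrite x0 mxE.
  rewrite isotropicE (bigD1 o) //= (bigD1 (hd o)) ?hdual_neq //=.
  rewrite hdualK // big1 => [|i /andP[i1 i2]]; last first.
    by rewrite xm ?qconj0 ?mul0r // (endptE _ eo) negb_or i1.
  rewrite /u /qinv; set r := (qnorm2 _)^-1; clearbody r.
  case: (x o 0) => a b c d; case: (x (hd o) 0) => a' b' c' d' /= e.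
  transitivity (- (r * (a * a' + b * b' + c * c' + d * d'))); first by ring.
  by rewrite (_ : a * a' + b * b' + c * c' + d * d' = 0) ?mulr0 ?oppr0 //; lra.
exists (uexp (transv (basev o) u) 1); split; [exact: unip_transv| |exact: transv_fix].
apply/matrixP => i j; rewrite (ord1 j) transv_act //.
rewrite [RHS]mxE big_ord1 !mxE eqxx mulr1n andbT.
case: eqP => [->|/eqP ih].
  by rewrite hdual_neq // mul0r /u -mulrA qmulVq // mulr1 addrN.
case: eqP => [->|/eqP io]; first by rewrite mul1r addr0.
by rewrite mul0r addr0 xm // (endptE _ eo) negb_or io.
Qed.

Lemma isotropic_reduce o (x : V) : endpt o -> x o 0 != 0 -> isotropic x ->
  exists h : M, [/\ unip h, h *m x = basev o *m (x o 0)%:M &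
      h *m basev (hd o) = basev (hd o)].
Proof.
move=> eo xo x0; have [h [uh hxo hm hf]] := kill_mid eo xo.
have [|k [uk kx kf]] := kill_end eo _ (isotropicM (unip_isom uh) x0) hm.
  by rewrite hxo.
exists (k *m h); split; first exact: unipM.
  by rewrite -mulmxA kx hxo.
by rewrite -mulmxA hf kf.
Qed.

Lemma qdomain (p q : H) : p != 0 -> q != 0 -> p * q != 0.
Proof.
move=> p0; apply: contra => /eqP e.
by rewrite -[q]mul1r -(qmulVq p0) -mulrA e mulr0.
Qed.

(** On vectors whose first and last coordinates vanish the form is positive definite. *)
Lemma isotropic_end (x : V) : isotropic x -> x != 0 ->
  x ord0 0 = 0 -> x ord_max 0 != 0.
Proof.
move=> x0 xN0 e0; apply: contra xN0 => /eqP en.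
have xE i : endpt i -> x i 0 = 0 by move=> /orP[]/eqP->.
have : qre ((x^h *m J *m x) 0 0) = 0 by rewrite x0 mxE.
rewrite isotropicE qre_sum (eq_bigr (fun i => qnorm2 (x i 0))) => [|i _].
  move/eqP; rewrite psumr_eq0 => [/allP s|i _]; last exact: qnorm2_ge0.
  apply/eqP/matrixP => i j; rewrite (ord1 j) mxE.
  by have := s i (mem_index_enum _); rewrite qnorm2_eq0 => /eqP.
have [ei|ei] := boolP (endpt i); last by rewrite hdual_mid // qconj_mul.
by rewrite !xE ?endpt_hdual // mulr0 /qnorm2 /=; ring.
Qed.

Lemma isotropic_to_basev (x : V) : isotropic x -> x != 0 ->
  exists2 h : M, unip h & h *m x = basev ord0.
Proof.
have e0 : endpt ord0 by rewrite /endpt eqxx.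
have en : endpt ord_max by rewrite /endpt eqxx orbT.
(* If the first coordinate vanishes, the last one does not, and the transvection with [u = i]
   carries it into the first. *)
wlog x0 : x / x ord0 0 != 0 => [hw ix xN0|ix _].
  have [x0|] := eqVneq (x ord0 0) 0; last by move=> x0; exact: hw.
  have xn := isotropic_end ix xN0 x0.
  pose u : H := Quat 0 1 0 0.
  have u0 : u != 0 by apply/eqP => -[] /eqP; rewrite oner_eq0.
  set g := uexp (transv (basev ord_max) u) 1.
  have ug : unip g by apply: unip_transv.
  have gx : (g *m x) ord0 0 != 0.
    by rewrite transv_act // hdual_max eqxx x0 add0r qdomain.
  have [||h uh hx] := hw (g *m x) gx.
  - by apply: isotropicM => //; exact: unip_isom.
  - by apply: contra gx => /eqP ->; rewrite mxE.
  by exists (h *m g); [exact: unipM | rewrite -mulmxA].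
have [h [uh hx _]] := isotropic_reduce e0 x0 ix.
set a := x ord0 0 in x0 hx.
(* A lower transvection by [v] followed by an upper one by [u] turns the first coordinate [a] into
   [(1 + u v) a], which is 1 when [u v = a^-1 - 1]. A second reduction then clears the other
   coordinates. *)
have [u [v [uI vI uv]]] := qimag_prod (qinv a - 1).
set g := uexp (transv (basev ord_max) u) 1 *m uexp (transv (basev ord0) v) 1 *m h.
have ug : unip g.
  by apply: unipM uh; apply: unipM; apply: unip_transv => //; exact: qre_imag.
have gx : (g *m x) ord0 0 = 1.
  rewrite /g -!mulmxA hx transv_act // hdual_max eqxx !transv_act // hdual0.
  rewrite eqxx (eq_sym ord0) nmax0 addr0 !mxE !big_ord1 !mxE !eqxx mulr1n.
  rewrite nmax0 mul1r mul0r add0r mulrA uv mulrBl mul1r qmulVq //.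
  by rewrite addrC subrK.
have gx0 : (g *m x) ord0 0 != 0 by rewrite gx oner_neq0.
have ig : isotropic (g *m x) by apply: isotropicM => //; exact: unip_isom.
have [k [uk kx _]] := isotropic_reduce e0 gx0 ig.
exists (k *m g); first exact: unipM.
by rewrite -mulmxA kx gx mulmx1.
Qed.

(** Once the first column is [e_0], the image [y] of [e_n] satisfies [<y, e_0> = <e_n, e_0> = 1], so
    its last coordinate is 1; reducing [y] with pivot [e_n] leaves [e_0] fixed. *)
Lemma isom_eliminate (A : M) : isom A -> exists h : M,
  [/\ unip h, h *m A *m basev ord0 = basev ord0 &
      h *m A *m basev ord_max = basev ord_max].
Proof.
move=> iA.
have e0 : endpt ord0 by rewrite /endpt eqxx.
have en : endpt ord_max by rewrite /endpt eqxx orbT.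
have [||h uh hA] := @isotropic_to_basev (A *m basev ord0).
- by apply: isotropicM => //; exact: isotropic_basev.
- apply/eqP => A0; have := congr1 (mulmx (A^h *m J)) A0.
  rewrite mulmx0 mulmxA iA gram_basev hdual0 => /matrixP/(_ ord_max 0)/eqP.
  by rewrite !mxE !eqxx oner_eq0.
set y := h *m A *m basev ord_max.
have ih : isom (h *m A) by apply: isomM => //; exact: unip_isom.
have iy : isotropic y by apply: isotropicM => //; exact: isotropic_basev.
have yn : y ord_max 0 = 1.
  have <- : row ord_max y 0 0 = y ord_max 0 by rewrite mxE.
  rewrite -basev_adjM -hdual0 -gram_basev adjmxM gram_adj //.
  have eA : basev ord0 = h *m A *m basev ord0 by rewrite -mulmxA.
  have -> : (basev ord0)^h *m J *m y =
      (basev ord0)^h *m ((h *m A)^h *m J *m (h *m A)) *m basev ord_max.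
    by rewrite {1}eA adjmxM /y !mulmxA.
  by rewrite ih -mulmxA gram_basev hdual_max basev_adjM !mxE !eqxx.
have [|k [uk ky kf]] := isotropic_reduce en _ iy; first by rewrite yn oner_neq0.
exists (k *m h); split; first exact: unipM.
- by rewrite -2!mulmxA hA -hdual_max.
- by rewrite -!mulmxA (mulmxA h) ky yn mulmx1.
Qed.

End Elimination.

(** * The trace defect *)

Section WordDefect.
Variables (T : pzRingType) (W : zmodType) (tau : T -> W).
Hypothesis tauC : forall x y, tau (x * y) = tau (y * x).

Definition cube (x : T) := x * x * x.

Definition word_defect (x y : T) : W :=
  tau (cube x * cube y * x * y) - tau (cube x * y * x * cube y).

Lemma word_defect_conj g g' x y : g' * g = 1 ->
  word_defect (g * x * g') (g * y * g') = word_defect x y.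
Proof.
move=> gg; have cM u v : g * u * g' * (g * v * g') = g * (u * v) * g'.
  by rewrite -!mulrA (mulrA g' g) gg mul1r.
have tC u : tau (g * u * g') = tau u by rewrite tauC mulrA gg mul1r.
by rewrite /word_defect /cube !cM !tC.
Qed.

Lemma word_defectNl x y : word_defect (- x) y = word_defect x y.
Proof. by rewrite /word_defect /cube !(mulNr, mulrN, opprK). Qed.

Lemma word_defectNr x y : word_defect x (- y) = word_defect x y.
Proof. by rewrite /word_defect /cube !(mulNr, mulrN, opprK). Qed.

(* Reversing the cyclic word x^3 y^3 x y yields the cyclic word x^3 y x y^3. *)
Lemma word_defect_anti (s : T -> T) x y :
  (forall u v, s (u * v) = s v * s u) -> (forall u, tau (s u) = tau u) ->
  word_defect (s x) (s y) = - word_defect x y.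
Proof.
move=> sM ts; rewrite /word_defect opprB.
have -> : cube (s x) * cube (s y) * s x * s y = s (y * x * cube y * cube x).
  by rewrite /cube !sM !mulrA.
have -> : cube (s x) * s y * s x * cube (s y) = s (cube y * x * y * cube x).
  by rewrite /cube !sM !mulrA.
by rewrite !ts; congr (_ - _); rewrite tauC !mulrA.
Qed.

Lemma word_defect1 : word_defect 1 1 = 0.
Proof. by rewrite /word_defect /cube !mulr1 subrr. Qed.

(** The two orthogonal summands never mix in a product, so each word is the sum of the words in
    either summand. *)
Lemma word_defectD x y x' y' :
  (forall u v, tau (u + v) = tau u + tau v) ->
  x * x' = 0 -> x' * x = 0 -> y * y' = 0 -> y' * y = 0 ->
  x * y' = 0 -> y' * x = 0 -> y * x' = 0 -> x' * y = 0 ->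
  word_defect (x + x') (y + y') = word_defect x y + word_defect x' y'.
Proof.
move=> tD h1 h2 h3 h4 h5 h6 h7 h8.
have mD (u u' v v' : T) : u * v' = 0 -> u' * v = 0 ->
    (u + u') * (v + v') = u * v + u' * v'.
  by move=> a b; rewrite mulrDl !mulrDr a b addr0 add0r.
have k (a b : T) : a * b = 0 -> forall z, a * (b * z) = 0.
  by move=> ab z; rewrite mulrA ab mul0r.
have hE := (h1, h2, h3, h4, h5, h6, h7, h8, k _ _ h1, k _ _ h2, k _ _ h3,
  k _ _ h4, k _ _ h5, k _ _ h6, k _ _ h7, k _ _ h8).
rewrite /word_defect /cube !mD; try by rewrite -!mulrA !(hE, mulr0).
all: try by rewrite ?hE.
by rewrite !tD opprD addrACA.
Qed.

End WordDefect.

(** The map [i] is only multiplicative, to allow the corner inclusion [embed], which sends 1 to the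
    idempotent [E *m E^h]. *)
Lemma word_defect_morph (T T' : pzRingType) (W : zmodType) (tau : T -> W)
    (tau' : T' -> W) (i : T' -> T) x y :
  (forall u v, i (u * v) = i u * i v) -> (forall u, tau (i u) = tau' u) ->
  word_defect tau (i x) (i y) = word_defect tau' x y.
Proof. by move=> iM ti; rewrite /word_defect /cube -!iM !ti. Qed.

Section TraceDefect.
Variable R : realType.
Local Notation H := (quat R).

Definition rtrace m (A : 'M[H]_m) : R := qre (\tr A).

Lemma rtraceC m (A B : 'M[H]_m) : rtrace (A * B) = rtrace (B * A).
Proof. exact: qre_mxtraceC. Qed.

Lemma rtraceD m (A B : 'M[H]_m) : rtrace (A + B) = rtrace A + rtrace B.
Proof. by rewrite /rtrace mxtraceD. Qed.

Definition trace_defect m := word_defect (@rtrace m).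

Definition blk (a b c d : H) : 'M[H]_(1 + 1) := block_mx a%:M b%:M c%:M d%:M.

Lemma scalar_mx0 m : (0 : H)%:M = 0 :> 'M[H]_m.
Proof. by apply/matrixP => i j; rewrite !mxE mul0rn. Qed.

Lemma blkM a b c d a' b' c' d' : blk a b c d * blk a' b' c' d' =
  blk (a * a' + b * c') (a * b' + b * d') (c * a' + d * c') (c * b' + d * d').
Proof. by rewrite -mulmxE /blk mulmx_block -!scalar_mxM -!raddfD. Qed.

Lemma rtrace_blk a b c d : rtrace (blk a b c d) = qre a + qre d.
Proof. by rewrite /rtrace mxtrace_block !mxtrace_scalar !mulr1n. Qed.

(* U(i) L(j) and U(j) L(k), with U(u) = [[1, u], [0, 1]] and L(v) = [[1, 0], [v, 1]] *)
Definition blkA := blk (Quat 1 0 0 1) (Quat 0 1 0 0) (Quat 0 0 1 0) (Quat 1 0 0 0).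
Definition blkB := blk (Quat 1 1 0 0) (Quat 0 0 1 0) (Quat 0 0 0 1) (Quat 1 0 0 0).

Lemma trace_defect_blk : trace_defect blkA blkB = 16.
Proof.
have bE a b c d a' b' c' d' : a = a' -> b = b' -> c = c' -> d = d' ->
    blk a b c d = blk a' b' c' d' by move=> -> -> -> ->.
have A3 : cube blkA = blk (Quat (-4) 0 0 5) (Quat 0 2 4 0) (Quat 0 4 2 0)
    (Quat 0 0 0 (-3)).
  by rewrite /cube /blkA !blkM; apply: bE; apply: quatP => /=; ring.
have B3 : cube blkB = blk (Quat (-4) 5 0 0) (Quat 0 0 2 4) (Quat 0 0 4 2)
    (Quat 0 (-3) 0 0).
  by rewrite /cube /blkB !blkM; apply: bE; apply: quatP => /=; ring.
have w1 : cube blkA * cube blkB * blkA =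
    blk (Quat 20 13 19 (-22)) (Quat (-2) (-10) (-20) (-25))
        (Quat 3 (-20) (-8) (-16)) (Quat 0 (-6) (-17) 16).
  by rewrite A3 B3 /blkA !blkM; apply: bE; apply: quatP => /=; ring.
have w2 : cube blkA * blkB * blkA =
    blk (Quat (-9) 3 3 (-2)) (Quat 0 (-7) 5 (-3))
        (Quat 1 5 (-4) (-3)) (Quat (-6) (-1) (-2) (-1)).
  by rewrite A3 /blkA /blkB !blkM; apply: bE; apply: quatP => /=; ring.
rewrite /trace_defect /word_defect w1 w2 B3 /blkB !blkM !rtrace_blk /=; ring.
Qed.

Variable n : nat.
Hypothesis n_gt0 : (0 < n)%N.
Local Notation M := 'M[H]_(n.+1).
Local Notation J := (gram R n).

(** Since [J^2 = 1], the isometry equation makes [J A^h J] a left inverse of [A], hence equal to any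
    right inverse. *)
Lemma isom_inv (A Ai : M) : isom A -> A *m Ai = 1%:M -> Ai = J *m A^h *m J.
Proof.
move=> iA AAi; rewrite -[RHS]mulmx1 -AAi mulmxA -(mulmxA J) -(mulmxA J) iA.
by rewrite gramK // mul1mx.
Qed.

(** Conjugating by [g] and cancelling signs gives f(A, B) = f(A^-1, B^-1). Inverses are adjoints
    conjugated by [J], and adjoints reverse words, so f(A, B) = - f(A, B). *)
Lemma trace_defect_reversible (A B g gi Ai Bi : M) :
  isom A -> isom B -> isom g ->
  A *m Ai = 1%:M -> B *m Bi = 1%:M -> g *m gi = 1%:M ->
  (g *m A *m gi = Ai \/ g *m A *m gi = - Ai) ->
  (g *m B *m gi = Bi \/ g *m B *m gi = - Bi) ->
  trace_defect A B = 0.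
Proof.
move=> iA iB ig AA BB gg rA rB.
have gig : gi *m g = 1%:M.
  by rewrite (isom_inv ig gg) -!mulmxA (mulmxA g^h) ig gramK.
have e : trace_defect (g *m A *m gi) (g *m B *m gi) = trace_defect Ai Bi.
  by case: rA => ->; case: rB => ->; rewrite /trace_defect ?word_defectNl ?word_defectNr.
have e1 : trace_defect (g *m A *m gi) (g *m B *m gi) = trace_defect A B.
  by apply: word_defect_conj => //; exact: rtraceC.
have e2 : trace_defect Ai Bi = trace_defect A^h B^h.
  rewrite (isom_inv iA AA) (isom_inv iB BB).
  by apply: word_defect_conj; [exact: rtraceC | exact: gramK].
have e3 : trace_defect A^h B^h = - trace_defect A B.
  apply: (word_defect_anti (@rtraceC _)).
  - by move=> u v; exact: adjmxM.
  - by move=> u; exact: qre_mxtrace_adj.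
by move: e; rewrite e1 e2 e3 => /eqP; rewrite -addr_eq0 -mulr2n mulrn_eq0 => /eqP.
Qed.

(** * Blocks on the hyperbolic plane of [e_0] and [e_n] *)

Definition endpts : 'M[H]_(n.+1, 1 + 1) := row_mx (basev R ord0) (basev R ord_max).
Local Notation E := endpts.

Lemma endpts_adj : E^h = col_mx (basev R (n := n) ord0)^h (basev R ord_max)^h.
Proof.
apply/matrixP => i j; rewrite mxE; case: (split_ordP i) => k ->.
  by rewrite row_mxEl col_mxEu [RHS]mxE.
by rewrite row_mxEr col_mxEd [RHS]mxE.
Qed.

Lemma endpts_orthonormal : E^h *m E = 1%:M.
Proof.
rewrite endpts_adj mul_col_row !basev_adjM [RHS]scalar_mx_block.
congr block_mx; apply/matrixP => i j; rewrite (ord1 i) (ord1 j) !mxE ?eqxx //=.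
  by rewrite eq_sym (ord_max_neq0 n_gt0).
by rewrite (ord_max_neq0 n_gt0).
Qed.

(** Puts a 2 x 2 block on the plane and zero elsewhere; it is multiplicative because
    [E^h *m E = 1]. *)
Definition embed (X : 'M[H]_(1 + 1)) : M := E *m X *m E^h.

Lemma embedM X Y : embed (X * Y) = embed X * embed Y.
Proof.
rewrite -!mulmxE /embed -!mulmxA; congr (_ *m (_ *m _)).
by rewrite (mulmxA E^h) endpts_orthonormal mul1mx.
Qed.

Lemma rtrace_embed X : rtrace (embed X) = rtrace X.
Proof.
by rewrite /rtrace /embed qre_mxtraceC mulmxA endpts_orthonormal mul1mx.
Qed.

Lemma embedD X Y : embed (X + Y) = embed X + embed Y.
Proof. by rewrite /embed mulmxDr mulmxDl. Qed.

Lemma embed_upper u : embed (blk 0 u 0 0) = transv (basev R ord_max) u.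
Proof.
rewrite /embed endpts_adj /endpts /blk mul_row_block mul_row_col.
rewrite !scalar_mx0 !mulmx0 !addr0 mul0mx add0r.
by rewrite /transv gram_basev // hdual_max.
Qed.

Lemma embed_lower v : embed (blk 0 0 v 0) = transv (basev R ord0) v.
Proof.
rewrite /embed endpts_adj /endpts /blk mul_row_block mul_row_col.
rewrite !scalar_mx0 !mulmx0 !add0r mul0mx addr0.
by rewrite /transv gram_basev // hdual0.
Qed.

Definition unip_block (u v : H) : M :=
  uexp (transv (basev R ord_max) u) 1 *m uexp (transv (basev R ord0) v) 1.

(** As [P] is the identity on the plane, it is [P - E *m E^h] plus [embed 1]. The transvections
    change only the second summand, into the block [U(u) L(v)]. *)
Lemma unip_blockE u v (P : M) :
  P *m E = E -> E^h *m P = E^h ->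
  unip_block u v *m P = (P - E *m E^h) + embed (blk (1 + u * v) u v 1).
Proof.
move=> PE EP.
have i0 : isotropic (basev R (ord0 : 'I_n.+1)).
  by apply: isotropic_basev; rewrite // /endpt eqxx.
have i1 : isotropic (basev R (ord_max : 'I_n.+1)).
  by apply: isotropic_basev; rewrite // /endpt eqxx orbT.
rewrite /unip_block (uexp_transv i0) (uexp_transv i1).
rewrite -embed_upper -embed_lower.
have eP X : embed X *m P = embed X by rewrite /embed -!mulmxA EP.
rewrite -mulmxA !mulmxDl !mul1mx mulmxDr !eP.
have -> : E *m E^h = embed 1 by rewrite /embed -[1]/1%:M mulmx1.
have -> : blk (1 + u * v) u v 1 =
    1 + blk 0 0 v 0 + (blk 0 u 0 0 + blk 0 u 0 0 * blk 0 0 v 0).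
  have -> : (1 : 'M[H]_(1 + 1)) = blk 1 0 0 1.
    by rewrite /blk !scalar_mx0 -[1]/1%:M scalar_mx_block.
  rewrite blkM /blk !add_block_mx -!raddfD /= !(mulr0, mul0r, addr0, add0r).
  by [].
by rewrite !embedD embedM -mulmxE !addrA subrK.
Qed.

Lemma unip_unip_block u v : qre u = 0 -> qre v = 0 -> unip (unip_block u v).
Proof.
by move=> u0 v0; apply: unipM; apply: unip_transv => //; rewrite /endpt eqxx ?orbT.
Qed.

(** Fixed columns give fixed rows: if [P e = e], then [(J e)^h P = (P e)^h J P = e^h J]. *)
Lemma isom_endpts_fixed (P : M) : isom P ->
  P *m basev R ord0 = basev R ord0 -> P *m basev R ord_max = basev R ord_max ->
  P *m E = E /\ E^h *m P = E^h.
Proof.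
move=> iP P0 Pn; have PE : P *m E = E by rewrite /E mul_mx_row P0 Pn.
split=> //.
have bP o : P *m basev R o = basev R o ->
    (basev R (hdual o))^h *m P = (basev R (hdual o))^h.
  move=> Po; rewrite -gram_basev // adjmxM gram_adj //.
  by rewrite -{1}Po adjmxM -mulmxA -mulmxA (mulmxA _ J) iP.
have b0 := bP _ P0; have bn := bP _ Pn.
rewrite hdual0 in b0; rewrite hdual_max // in bn.
by rewrite endpts_adj mul_col_mx b0 bn.
Qed.

Lemma trace_defect_embed (P Q : M) X Y :
  P *m E = E -> E^h *m P = E^h -> Q *m E = E -> E^h *m Q = E^h ->
  trace_defect (P - E *m E^h + embed X) (Q - E *m E^h + embed Y) =
  trace_defect (P - E *m E^h) (Q - E *m E^h) + trace_defect X Y.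
Proof.
move=> PE EP QE EQ.
have lz (S : M) Z : S *m E = E -> (S - E *m E^h) * embed Z = 0.
  move=> SE; have e : (S - E *m E^h) *m E = 0.
    by rewrite mulmxBl SE -mulmxA endpts_orthonormal mulmx1 subrr.
  by rewrite -mulmxE /embed !mulmxA e !mul0mx.
have rz (S : M) Z : E^h *m S = E^h -> embed Z * (S - E *m E^h) = 0.
  move=> ES; have e : E^h *m (S - E *m E^h) = 0.
    by rewrite mulmxBr ES mulmxA endpts_orthonormal mul1mx subrr.
  by rewrite -mulmxE /embed -!mulmxA e !mulmx0.
rewrite /trace_defect word_defectD; try by [exact: rtraceD | exact: lz | exact: rz].
congr (_ + _); apply: word_defect_morph; [exact: embedM | exact: rtrace_embed].
Qed.

Local Notation qI := (Quat 0 1 0 0 : H).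
Local Notation qJ := (Quat 0 0 1 0 : H).
Local Notation qK := (Quat 0 0 0 1 : H).

Lemma trace_defect_unip_block (P Q : M) :
  P *m E = E -> E^h *m P = E^h -> Q *m E = E -> E^h *m Q = E^h ->
  trace_defect P Q = 0 ->
  trace_defect (unip_block qI qJ *m P) (unip_block qJ qK *m Q) = 16.
Proof.
move=> PE EP QE EQ d0.
apply: (etrans (congr2 (@trace_defect n.+1)
  (unip_blockE qI qJ PE EP) (unip_blockE qJ qK QE EQ))).
apply: (etrans (trace_defect_embed _ _ PE EP QE EQ)).
have e1 : embed 1 = E *m E^h by rewrite /embed -[1]/1%:M mulmx1.
have z : trace_defect (P - E *m E^h) (Q - E *m E^h) = 0.
  (* Identity blocks give back [P] and [Q] and contribute defect 0, so the complementary parts have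
     defect 0 as well. *)
  have := trace_defect_embed 1 1 PE EP QE EQ.
  have -> : trace_defect (1 : 'M[H]_(1 + 1)) 1 = 0 by exact: word_defect1.
  by rewrite e1 addr0 2!subrK => <-.
rewrite z add0r -trace_defect_blk.
have eA : 1 + qI * qJ = Quat 1 0 0 1 by apply: quatP => /=; ring.
have eB : 1 + qJ * qK = Quat 1 1 0 0 by apply: quatP => /=; ring.
exact: (congr2 (fun x y => trace_defect (blk x qI qJ 1) (blk y qJ qK 1)) eA eB).
Qed.

Lemma unip_trace_defect_neq0 (A B : M) : isom A -> isom B -> exists h k : M,
  [/\ unip h, unip k & trace_defect (h *m A) (k *m B) != 0].
Proof.
move=> iA iB.
have [h [uh h0 hn]] := isom_eliminate n_gt0 iA.
have [k [uk k0 kn]] := isom_eliminate n_gt0 iB.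
have [PE EP] := isom_endpts_fixed (isomM (unip_isom uh) iA) h0 hn.
have [QE EQ] := isom_endpts_fixed (isomM (unip_isom uk) iB) k0 kn.
(* If elimination already yields a nonzero defect, it is kept; otherwise the plane blocks raise it
   from 0 to 16. *)
have [d0|dN0] := pselect (trace_defect (h *m A) (k *m B) = 0); last first.
  by exists h, k; split=> //; apply/eqP.
exists (unip_block qI qJ *m h), (unip_block qJ qK *m k); split.
- by apply: unipM uh; exact: unip_unip_block.
- by apply: unipM uk; exact: unip_unip_block.
have e : trace_defect (unip_block qI qJ *m h *m A) (unip_block qJ qK *m k *m B) = 16.
  apply: (etrans (congr2 (@trace_defect n.+1) (esym (mulmxA _ h A))
    (esym (mulmxA _ k B)))).
  exact: trace_defect_unip_block.
by rewrite e pnatr_eq0.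
Qed.

End TraceDefect.

(** * Polynomial functions *)

Section PolynomialFunctions.
Variable R : realType.
Local Notation H := (quat R).

(** The algebra of functions generated by [B]. Continuity, boundedness on a set and polynomial
    dependence on a parameter pass from the generators by induction. *)
Inductive polyf (X : Type) (B : set (X -> R)) : (X -> R) -> Prop :=
| polyf_base f : B f -> polyf B f
| polyf_cst c : polyf B (fun=> c)
| polyfD f g : polyf B f -> polyf B g -> polyf B (fun x => f x + g x)
| polyfM f g : polyf B f -> polyf B g -> polyf B (fun x => f x * g x).

Section Closure.
Variables (X : Type) (B : set (X -> R)).

Lemma eq_polyf (f g : X -> R) : f =1 g -> polyf B f -> polyf B g.
Proof. by move=> /funext ->. Qed.

Lemma polyfN f : polyf B f -> polyf B (fun x => - f x).
Proof.
move=> Bf; apply: (@eq_polyf (fun x => -1 * f x)) => [x|]; first by rewrite mulN1r.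
by apply: polyfM => //; exact: polyf_cst.
Qed.

Lemma polyfB f g : polyf B f -> polyf B g -> polyf B (fun x => f x - g x).
Proof. by move=> Bf Bg; apply: polyfD => //; exact: polyfN. Qed.

Definition qpolyf (F : X -> H) :=
  [/\ polyf B (fun x => qre (F x)), polyf B (fun x => qi (F x)),
      polyf B (fun x => qj (F x)) & polyf B (fun x => qk (F x))].

Lemma qpolyf_cst q : qpolyf (fun=> q).
Proof. by split; exact: polyf_cst. Qed.

Lemma qpolyf_real f : polyf B f -> qpolyf (fun x => qreal (f x)).
Proof. by move=> Bf; split => //=; exact: polyf_cst. Qed.

Lemma qpolyfD F G : qpolyf F -> qpolyf G -> qpolyf (fun x => F x + G x).
Proof. by move=> [? ? ? ?] [? ? ? ?]; split => /=; exact: polyfD. Qed.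

Lemma qpolyfM F G : qpolyf F -> qpolyf G -> qpolyf (fun x => F x * G x).
Proof.
move=> [? ? ? ?] [? ? ? ?]; split => /=; do ![exact: polyfM|apply: polyfB|apply: polyfD].
Qed.

Lemma qpolyf_conj F : qpolyf F -> qpolyf (fun x => qconj (F x)).
Proof. by move=> [? ? ? ?]; split => //=; exact: polyfN. Qed.

Lemma qpolyf_sum I (s : seq I) (F : I -> X -> H) :
  (forall i, qpolyf (F i)) -> qpolyf (fun x => \sum_(i <- s) F i x).
Proof.
move=> BF; elim: s => [|i s IHs].
  have -> : (fun x => \sum_(i <- [::]) F i x) = (fun=> 0).
    by apply/funext => x; rewrite big_nil.
  exact: qpolyf_cst.
have -> : (fun x => \sum_(j <- i :: s) F j x) =
    (fun x => F i x + \sum_(j <- s) F j x).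
  by apply/funext => x; rewrite big_cons.
exact: qpolyfD.
Qed.

Definition mpolyf m p (F : X -> 'M[H]_(m, p)) :=
  forall i j, qpolyf (fun x => F x i j).

Lemma mpolyf_cst m p (A : 'M[H]_(m, p)) : mpolyf (fun=> A).
Proof. by move=> i j; exact: qpolyf_cst. Qed.

Lemma mpolyfD m p (F G : X -> 'M[H]_(m, p)) :
  mpolyf F -> mpolyf G -> mpolyf (fun x => F x + G x).
Proof.
move=> BF BG i j.
have -> : (fun x => (F x + G x) i j) = (fun x => F x i j + G x i j).
  by apply/funext => x; rewrite mxE.
exact: qpolyfD.
Qed.

Lemma mpolyfZ m p f (F : X -> 'M[H]_(m, p)) :
  polyf B f -> mpolyf F -> mpolyf (fun x => qreal (f x) *: F x).
Proof.
move=> Bf BF i j.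
have -> : (fun x => (qreal (f x) *: F x) i j) = (fun x => qreal (f x) * F x i j).
  by apply/funext => x; rewrite mxE.
by apply: qpolyfM => //; exact: qpolyf_real.
Qed.

Lemma mpolyfM m p r (F : X -> 'M[H]_(m, p)) (G : X -> 'M[H]_(p, r)) :
  mpolyf F -> mpolyf G -> mpolyf (fun x => F x *m G x).
Proof.
move=> BF BG i j.
have -> : (fun x => (F x *m G x) i j) = (fun x => \sum_k F x i k * G x k j).
  by apply/funext => x; rewrite mxE.
by apply: qpolyf_sum => k; exact: qpolyfM.
Qed.

Lemma mpolyf_adj m p (F : X -> 'M[H]_(m, p)) :
  mpolyf F -> mpolyf (fun x => (F x)^h).
Proof.
move=> BF i j.
have -> : (fun x => (F x)^h i j) = (fun x => qconj (F x j i)).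
  by apply/funext => x; rewrite mxE.
exact: qpolyf_conj.
Qed.

Lemma mpolyf_tr m (F : X -> 'M[H]_m) :
  mpolyf F -> polyf B (fun x => qre (\tr (F x))).
Proof.
by move=> BF; have [] : qpolyf (fun x => \tr (F x)) by exact: qpolyf_sum.
Qed.

End Closure.

Lemma polyf_comp (X Y : Type) (B : set (X -> R)) (C : set (Y -> R)) (g : Y -> X) f :
  (forall b, B b -> polyf C (b \o g)) -> polyf B f -> polyf C (f \o g).
Proof.
move=> Bg; elim=> [b /Bg//|c|f1 f2 _ h1 _ h2|f1 f2 _ h1 _ h2].
- exact: polyf_cst.
- exact: polyfD h1 h2.
- exact: polyfM h1 h2.
Qed.

Lemma polyf_continuous (X : topologicalType) (B : set (X -> R)) f :
  (forall b, B b -> continuous b) -> polyf B f -> continuous f.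
Proof.
move=> cB; elim=> [b /cB//|c|f1 f2 _ h1 _ h2|f1 f2 _ h1 _ h2] x.
- exact: cvg_cst.
- by apply: cvgD; [exact: h1|exact: h2].
- by apply: cvgM; [exact: h1|exact: h2].
Qed.

Lemma polyf_bounded (X : Type) (B : set (X -> R)) (D : set X) f :
  (forall b, B b -> exists C, forall x, D x -> `|b x| <= C) ->
  polyf B f -> exists C, forall x, D x -> `|f x| <= C.
Proof.
move=> bB; elim=> [b /bB//|c|f1 f2 _ [C1 h1] _ [C2 h2]|f1 f2 _ [C1 h1] _ [C2 h2]].
- by exists `|c|.
- by exists (C1 + C2) => x Dx; rewrite (le_trans (ler_normD _ _))// lerD ?h1 ?h2.
- by exists (C1 * C2) => x Dx; rewrite normrM ler_pM ?h1 ?h2.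
Qed.

(** The bound [d] is uniform in [x]; it bounds the number of coefficients, one more than the
    degree. *)
Definition poly_in_fst (X : Type) (g : R * X -> R) := exists d : nat, forall x,
  exists2 p : {poly R}, (size p <= d)%N & forall t, g (t, x) = p.[t].

Lemma polyf_poly_in_fst (X : Type) (B : set (R * X -> R)) g :
  (forall b, B b -> poly_in_fst b) -> polyf B g -> poly_in_fst g.
Proof.
move=> hB; elim=> [b /hB//|c|f1 f2 _ [d1 h1] _ [d2 h2]|f1 f2 _ [d1 h1] _ [d2 h2]].
- exists 1%N => x; exists c%:P; first exact: size_polyC_leq1.
  by move=> t; rewrite hornerC.
- exists (maxn d1 d2) => x; have [p1 s1 e1] := h1 x; have [p2 s2 e2] := h2 x.
  exists (p1 + p2); last by move=> t; rewrite e1 e2 hornerD.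
  by rewrite (leq_trans (size_polyD _ _))// geq_max !leq_max s1 s2 orbT.
- exists (d1 + d2)%N => x; have [p1 s1 e1] := h1 x; have [p2 s2 e2] := h2 x.
  exists (p1 * p2); last by move=> t; rewrite e1 e2 hornerM.
  by rewrite (leq_trans (size_polyMleq _ _))// (leq_trans (leq_pred _))// leq_add.
Qed.

End PolynomialFunctions.

(** * Compact boxes of matrices, and measures of families with bounded multiplicity *)

Lemma matrix_box_compact (R : realType) m p (C : R) :
  compact [set A : 'M[R]_(m, p) | forall i j, `|A i j| <= C].
Proof.
have cK : compact [set v : 'rV[R]_(m * p) | forall k, `[- C, C]%classic (v 0 k)].
  by apply: (@rV_compact R _ (fun=> `[- C, C]%classic)) => _; exact: segment_compact.
(* The box is the image under [vec_mx] of a compact box of row vectors. A basic matrix neighbourhood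
   constrains finitely many entries, whence continuity. *)
have cv : continuous (@vec_mx R m p : 'rV[R]_(m * p) -> 'M[R]_(m, p)).
  move=> v A [P vP sPA].
  have : nbhs v [set w : 'rV[R]_(m * p) | forall i j, P i j (w 0 (mxvec_index i j))].
    apply: (filter_forall (F := nbhs v)) => i.
    apply: (filter_forall (F := nbhs v)) => j.
    have := vP i j; rewrite mxE => vPij.
    exact: (@coord_continuous R 1 (m * p) 0 (mxvec_index i j) v _ vPij).
  by apply: filterS => w hw; apply: sPA => i j; rewrite mxE.
have := continuous_compact (continuous_subspaceT cv) cK.
congr compact; apply/seteqP; split => [_ [v hv <-] i j|A hA] /=.
  by have := hv (mxvec_index i j); rewrite mxE /= in_itv /= -ler_norml.
exists (mxvec A); last exact: mxvecK.
move=> k; case/mxvec_indexP: k => i j.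
by rewrite mxvecE /= in_itv /= -ler_norml; exact: hA.
Qed.

(** Integrates the pointwise inequality between the sum of the indicators of [X k] and [D] times the
    indicator of [K]. *)
Lemma sum_measure_le d (T : measurableType d) (R : realType)
    (mu : {measure set T -> \bar R}) (X : nat -> set T) (K : set T) (D N : nat) :
  (forall k, measurable (X k)) -> measurable K -> (forall k, X k `<=` K) ->
  (forall x, (\sum_(k < N) (x \in X k) <= D)%N) ->
  (\sum_(k < N) mu (X k) <= D%:R%:E * mu K)%E.
Proof.
move=> mX mK XK xD.
have iE A : measurable A -> mu A = (\int[mu]_x (\1_A x)%:E)%E.
  by move=> mA; rewrite integral_indic // setIT.
rewrite (eq_bigr (fun k : 'I_N => \int[mu]_x (\1_(X k) x)%:E)%E); last first.
  by move=> k _; exact: iE.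
rewrite -(ge0_integral_sum _ measurableT); last 2 first.
- by move=> k; apply/measurable_EFinP; exact: measurable_indic.
- by move=> k x _; rewrite lee_fin.
rewrite (iE K) // -ge0_integralZl //; last first.
  by apply/measurable_EFinP; exact: measurable_indic.
apply: ge0_le_integral => //.
- by move=> x _; apply: sume_ge0 => k _; rewrite lee_fin.
- apply: emeasurable_sum => k.
  by apply/measurable_EFinP; exact: measurable_indic.
- apply: emeasurable_funM => //.
  by apply/measurable_EFinP; exact: measurable_indic.
move=> x _; rewrite sumEFin -EFinM lee_fin.
rewrite (eq_bigr (fun k : 'I_N => (x \in X k)%:R)) => [|k _]; last by rewrite indicE.
rewrite -natr_sum indicE; have [xK|xK] := boolP (x \in K).
  by rewrite mulr1 ler_nat.
rewrite mulr0 big1 // => k _; apply/eqP; rewrite eqb0.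
by apply: contra xK; rewrite !inE; exact: XK.
Qed.

(** * The groups Sp(n,1) as matrix groups *)

Section Bridge.
Variables (R : realType) (n : nat).
Local Notation H := (quat R).
Local Notation M := 'M[H]_(n.+1).

Definition mx_of_qmat (A : qmat R n) : M := \matrix_(i, j) qentry A i j.
Definition qmat_of_mx (A : M) : qmat R n := qmat_of (fun i j => A i j).

Lemma mx_of_qmatK : cancel mx_of_qmat qmat_of_mx.
Proof.
case=> [[A B] [C D]]; rewrite /qmat_of_mx /qmat_of.
by congr ((_, _), (_, _)); apply/matrixP => i j; rewrite !mxE.
Qed.

Lemma qentry_qmat_of f i j : qentry (qmat_of f : qmat R n) i j = f i j.
Proof. by apply: quatP; rewrite /= !mxE. Qed.

Lemma qmat_of_mxK : cancel qmat_of_mx mx_of_qmat.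
Proof. by move=> A; apply/matrixP => i j; rewrite mxE qentry_qmat_of. Qed.

Lemma mx_of_qmatM A B :
  mx_of_qmat (qmatmul A B) = mx_of_qmat A *m mx_of_qmat B.
Proof.
apply/matrixP => i j; rewrite mxE qentry_qmat_of mxE.
by apply: eq_bigr => k _; rewrite !mxE.
Qed.

Lemma mx_of_qmat1 : mx_of_qmat (qmat1 R n) = 1%:M.
Proof.
by apply/matrixP => i j; rewrite mxE qentry_qmat_of mxE; case: eqP.
Qed.

Lemma mx_of_qmatN A : mx_of_qmat (qmatopp A) = - mx_of_qmat A.
Proof. by apply/matrixP => i j; rewrite mxE qentry_qmat_of !mxE. Qed.

Hypothesis n_gt0 : (0 < n)%N.

Definition cv_of_qvec (z : qvec R n) : 'cV[H]_(n.+1) := \col_i z i.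

Lemma hformE (z w : qvec R n) :
  hform z w = ((cv_of_qvec w)^h *m gram R n *m cv_of_qvec z) 0 0.
Proof.
rewrite -mulmxA mxE (bigD1 ord_max) //= (bigD1 ord0) /=; last first.
  by rewrite eq_sym ord_max_neq0.
rewrite !gramE !mxE hdual0 hdual_max // /hform.
congr (_ + _); rewrite [RHS]addrC; congr (_ + _).
apply: eq_big => [i|i /andP[i0 iM]].
  by rewrite -!val_eqE /= andbC lt0n ltn_neqAle -ltnS ltn_ord andbT.
rewrite gramE !mxE hdual_mid // /endpt -!val_eqE /= negb_or.
by rewrite -lt0n i0 (ltn_eqF iM).
Qed.

Lemma cv_of_qact A z : cv_of_qvec (qact A z) = mx_of_qmat A *m cv_of_qvec z.
Proof.
apply/matrixP => i j; rewrite !mxE; apply: eq_bigr => k _.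
by rewrite !mxE.
Qed.

(** For the direct implication the form is tested on pairs of basis vectors, where it reads off the
    entries of [A^h J A] and [J]. *)
Lemma SpP (A : qmat R n) : Sp A <-> isom (mx_of_qmat A).
Proof.
split=> [sA|iA z w]; last first.
  rewrite !hformE !cv_of_qact adjmxM.
  by rewrite -!mulmxA (mulmxA _ _ (_ *m cv_of_qvec z)) (mulmxA _ _ (cv_of_qvec z)) iA.
pose e (j : 'I_n.+1) : qvec R n := fun i => (i == j)%:R.
have eE j : cv_of_qvec (e j) = basev R j.
  by apply/matrixP => i k; rewrite !mxE (ord1 k) eqxx andbT.
apply/matrixP => i j; have := sA (e j) (e i); rewrite !hformE !cv_of_qact !eE.
rewrite adjmxM -!mulmxA !basev_adjM [LHS]mxE [RHS]mxE.
have colE (B : M) : (B *m basev R j) i 0 = B i j.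
  by rewrite mxE (bigD1 j) //= mxE !eqxx mulr1 big1 ?addr0 // => k kj;
    rewrite mxE (negPf kj) mulr0.
by rewrite !mulmxA !colE.
Qed.

Lemma reversible_trace_defect (p : qpair R n) : SpSp p ->
  psp_strongly_doubly_reversible p.1 p.2 ->
  trace_defect (mx_of_qmat p.1) (mx_of_qmat p.2) = 0.
Proof.
move=> [/SpP iA /SpP iB] [g [gi [Ai [Bi]]]].
move=> [[/SpP ig _ _ _] [[gg AA BB] [_ rA rB]]].
have mE X Y : qmatmul X Y = qmat1 R n -> mx_of_qmat X *m mx_of_qmat Y = 1%:M.
  by move=> /(congr1 mx_of_qmat); rewrite mx_of_qmatM mx_of_qmat1.
have rE X Y : psp_eq (qmatmul (qmatmul g X) gi) Y ->
    mx_of_qmat g *m mx_of_qmat X *m mx_of_qmat gi = mx_of_qmat Y \/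
    mx_of_qmat g *m mx_of_qmat X *m mx_of_qmat gi = - mx_of_qmat Y.
  by case=> /(congr1 mx_of_qmat); rewrite ?mx_of_qmatN !mx_of_qmatM; [left|right].
exact: (trace_defect_reversible n_gt0 iA iB ig (mE _ _ AA) (mE _ _ BB) (mE _ _ gg)
  (rE _ _ rA) (rE _ _ rB)).
Qed.

End Bridge.

(** * Coordinates on pairs *)

Section Coordinates.
Variables (R : realType) (n : nat).
Local Notation H := (quat R).
Local Notation M := 'M[H]_(n.+1).
Local Notation mx := (@mx_of_qmat R n).
Local Notation X := (qpair R n).

Definition qcomp (c : bool * bool) (q : H) : R :=
  match c with
  | (false, false) => qre q | (false, true) => qi q
  | (true, false) => qj q | (true, true) => qk q
  end.

(** The index gives the matrix of the pair ([true] for the first), the quaternion component, and the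
    entry. *)
Definition qcoord (a : bool * (bool * bool) * ('I_n.+1 * 'I_n.+1)) (x : X) : R :=
  qcomp a.1.2 (mx (if a.1.1 then x.1 else x.2) a.2.1 a.2.2).

Definition qcoords : set (X -> R) := range qcoord.

Lemma fst_continuous (U V : topologicalType) : continuous (@fst U V).
Proof. by move=> x; exact: cvg_fst. Qed.

Lemma snd_continuous (U V : topologicalType) : continuous (@snd U V).
Proof. by move=> x; exact: cvg_snd. Qed.

Lemma qcoord_continuous a : continuous (qcoord a).
Proof.
have cc (p : X -> 'M[R]_(n.+1)) i j : continuous p -> continuous (fun x => p x i j).
  move=> cp x; apply: (@continuous_comp _ _ _ p (fun A : 'M[R]_(n.+1) => A i j)).
    exact: cp.
  exact: coord_continuous.
have c1 (U V : topologicalType) (p : X -> (U * V)%type) :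
    continuous p -> continuous (fun x => (p x).1).
  by move=> cp x; exact: (continuous_comp (cp x) (@fst_continuous _ _ (p x))).
have c2 (U V : topologicalType) (p : X -> (U * V)%type) :
    continuous p -> continuous (fun x => (p x).2).
  by move=> cp x; exact: (continuous_comp (cp x) (@snd_continuous _ _ (p x))).
case: a => [[s [a b]] [i j]]; rewrite /qcoord /=.
have cs : continuous (fun x : X => if s then x.1 else x.2).
  by case: s; [exact: fst_continuous | exact: snd_continuous].
have -> : (fun x : X => qcomp (a, b) (mx (if s then x.1 else x.2) i j)) =
    (fun x : X => let A := if s then x.1 else x.2 in
       (if a then (if b then A.2.2 else A.2.1)
        else (if b then A.1.2 else A.1.1)) i j).
  by apply/funext => x; rewrite mxE; case: a; case: b.
apply: cc; have cs1 := c1 _ _ _ cs; have cs2 := c2 _ _ _ cs.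
by case: a; case: b; [exact: c2 cs2|exact: c1 cs2|exact: c2 cs1|exact: c1 cs1].
Qed.

Lemma qcoords_continuous f : qcoords f -> continuous f.
Proof. by move=> [a _ <-]; exact: qcoord_continuous. Qed.

Definition polymap (Y : Type) (C : set (Y -> R)) (h : Y -> X) :=
  mpolyf C (fun y => mx (h y).1) /\ mpolyf C (fun y => mx (h y).2).

Lemma polyf_polymap (Y : Type) (C : set (Y -> R)) (h : Y -> X) f :
  polyf qcoords f -> polymap C h -> polyf C (f \o h).
Proof.
move=> pf [h1 h2]; apply: polyf_comp pf => _ [[[s [c1 c2]] [i j]] _ <-].
have [? ? ? ?] := h1 i j; have [? ? ? ?] := h2 i j.
by case: s; case: c1; case: c2.
Qed.

Lemma polymap_id : polymap qcoords id.
Proof.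
by split=> i j; split; apply: polyf_base;
  [exists (true, (false, false), (i, j))|exists (true, (false, true), (i, j))
  |exists (true, (true, false), (i, j))|exists (true, (true, true), (i, j))
  |exists (false, (false, false), (i, j))|exists (false, (false, true), (i, j))
  |exists (false, (true, false), (i, j))|exists (false, (true, true), (i, j))].
Qed.

Lemma polymap_lmul2 (Y : Type) (C : set (Y -> R)) (g h : Y -> X) :
  polymap C g -> polymap C h -> polymap C (fun y => lmul2 (g y) (h y)).
Proof.
move=> [g1 g2] [h1 h2]; split.
  have -> : (fun y => mx (lmul2 (g y) (h y)).1) =
      (fun y => mx (g y).1 *m mx (h y).1).
    by apply/funext => y; exact: mx_of_qmatM.
  exact: mpolyfM.
have -> : (fun y => mx (lmul2 (g y) (h y)).2) =
    (fun y => mx (g y).2 *m mx (h y).2).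
  by apply/funext => y; exact: mx_of_qmatM.
exact: mpolyfM.
Qed.

Lemma polymap_cst (Y : Type) (C : set (Y -> R)) g : polymap C (fun=> g).
Proof. by split; exact: mpolyf_cst. Qed.

Lemma polyf_lmul2 f g : polyf qcoords f -> polyf qcoords (fun x => f (lmul2 g x)).
Proof.
move=> pf; apply: (polyf_polymap pf (h := fun x => lmul2 g x)).
by apply: polymap_lmul2; [exact: polymap_cst | exact: polymap_id].
Qed.

Lemma polyf_closed_eq f c : polyf qcoords f -> closed [set x : X | f x = c].
Proof.
move=> pf; apply: (preimage_closed (D := [set y | y = c])); last exact: closed_eq.
by move=> x _; apply: (polyf_continuous qcoords_continuous pf).
Qed.

Lemma polyf_open_neq f c : polyf qcoords f -> open [set x : X | f x != c].
Proof.
move=> pf; apply: (open_comp (D := [set y | y != c])); last exact: open_neq.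
by move=> x _; apply: (polyf_continuous qcoords_continuous pf).
Qed.

Lemma polyf_closed_le f c : polyf qcoords f -> closed [set x : X | f x <= c].
Proof.
move=> pf; apply: (preimage_closed (D := [set y | y <= c])); last exact: closed_le.
by move=> x _; apply: (polyf_continuous qcoords_continuous pf).
Qed.

Lemma mpolyf_closed_eq m p (F : X -> 'M[H]_(m, p)) A :
  mpolyf qcoords F -> closed [set x : X | F x = A].
Proof.
move=> pF; have -> : [set x | F x = A] = \bigcap_ij
    ([set x | qre (F x ij.1 ij.2) = qre (A ij.1 ij.2)] `&`
     [set x | qi (F x ij.1 ij.2) = qi (A ij.1 ij.2)] `&`
     [set x | qj (F x ij.1 ij.2) = qj (A ij.1 ij.2)] `&`
     [set x | qk (F x ij.1 ij.2) = qk (A ij.1 ij.2)]).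
  apply/seteqP; split=> [x /= xA [i j] _|x xF]; first by rewrite /= xA.
  by apply/matrixP => i j; have [[[]]] := xF (i, j) I; exact: quatP.
apply: closed_bigI => -[i j] _; have [p1 p2 p3 p4] := pF i j.
by do 3!(apply: closedI; last exact: polyf_closed_eq); exact: polyf_closed_eq.
Qed.

Definition box (C : R) : set X := [set x | forall a, `|qcoord a x| <= C].

Lemma box_compact C : compact (box C).
Proof.
pose B := [set A : 'M[R]_(n.+1) | forall i j, `|A i j| <= C].
have cB : compact B by exact: matrix_box_compact.
have cQ : compact ((B `*` B) `*` (B `*` B)) by do 2!apply: compact_setX.
have := compact_setX cQ cQ; congr compact; apply/seteqP; split.
  move=> [[[A1 A2] [A3 A4]] [[B1 B2] [B3 B4]]] /=.
  move=> [[[h1 h2] [h3 h4]] [[k1 k2] [k3 k4]]] [[s [c1 c2]] [i j]].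
  by rewrite /qcoord /= mxE; case: s; case: c1; case: c2 => /=.
move=> [[[A1 A2] [A3 A4]] [[B1 B2] [B3 B4]]] hb; rewrite /B.
have e s c1 c2 i j := hb (s, (c1, c2), (i, j)).
by split; split; split => i j; [have := e true false false i j|have := e true false true i j
  |have := e true true false i j|have := e true true true i j
  |have := e false false false i j|have := e false false true i j
  |have := e false true false i j|have := e false true true i j];
  rewrite /qcoord /= mxE.
Qed.

Lemma box_closed_comp C (h : X -> X) :
  polymap qcoords h -> closed [set x | box C (h x)].
Proof.
move=> ph; have -> : [set x | box C (h x)] = \bigcap_a
    ([set x | qcoord a (h x) <= C] `&` [set x | - qcoord a (h x) <= C]).
  apply/seteqP; split=> [x xb a _|x xb a] /=.
    by have := xb a; rewrite ler_norml => /andP[h1 h2]; split; rewrite // lerNl.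
  by have [/= h1 h2] := xb a I; rewrite ler_norml h1 andbT lerNl.
apply: closed_bigI => a _.
have pa : polyf qcoords (qcoord a) by apply: polyf_base; exists a.
have pah := polyf_polymap pa ph.
by apply: closedI; apply: polyf_closed_le => //; exact: polyfN.
Qed.

Lemma bigcup_box : \bigcup_k box k%:R = setT.
Proof.
apply/seteqP; split=> // x _; pose C := \sum_a `|qcoord a x|.
exists (Num.Def.archi_bound C) => // a.
have C0 : 0 <= C by apply: sumr_ge0.
apply: le_trans (ltW (archi_boundP C0)); rewrite /C (bigD1 a) //= lerDl.
exact: sumr_ge0.
Qed.

Hypothesis n_gt0 : (0 < n)%N.

Lemma SpSpE (x : X) : SpSp x <-> isom (mx x.1) /\ isom (mx x.2).
Proof. by rewrite /SpSp /=; split=> -[] /(SpP n_gt0) ? /(SpP n_gt0) ?. Qed.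

Lemma SpSp_closed_comp (h : X -> X) :
  polymap qcoords h -> closed [set x | SpSp (h x)].
Proof.
move=> [h1 h2]; have -> : [set x | SpSp (h x)] =
    [set x | (mx (h x).1)^h *m gram R n *m mx (h x).1 = gram R n] `&`
    [set x | (mx (h x).2)^h *m gram R n *m mx (h x).2 = gram R n].
  by apply/seteqP; split=> x /=; rewrite SpSpE.
by apply: closedI; apply: mpolyf_closed_eq; (apply: mpolyfM => //);
  apply: mpolyfM; [exact: mpolyf_adj|exact: mpolyf_cst
                  |exact: mpolyf_adj|exact: mpolyf_cst].
Qed.

End Coordinates.

(** * Null sets *)

HB.instance Definition _ (U V : ptopologicalType) := Pointed.on (U * V)%type.

Section Nullity.
Variables (R : realType) (n : nat).
Hypothesis n_gt0 : (0 < n)%N.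
Local Notation H := (quat R).
Local Notation M := 'M[H]_(n.+1).
Local Notation mx := (@mx_of_qmat R n).
Local Notation X := (qpair R n).
Local Notation qcoords := (@qcoords R n).

Definition pair_of_mx (g h : M) : X := (qmat_of_mx g, qmat_of_mx h).

Lemma lmul2_pairM g g' h h' x :
  lmul2 (pair_of_mx g h) (lmul2 (pair_of_mx g' h') x) =
  lmul2 (pair_of_mx (g *m g') (h *m h')) x.
Proof.
congr pair; apply: (can_inj (@mx_of_qmatK R n));
  by rewrite /= !mx_of_qmatM !qmat_of_mxK mulmxA.
Qed.

Lemma lmul2_pair1 x : lmul2 (pair_of_mx 1%:M 1%:M) x = x.
Proof.
rewrite [RHS]surjective_pairing.
congr pair; apply: (can_inj (@mx_of_qmatK R n));
  by rewrite /= mx_of_qmatM qmat_of_mxK mul1mx.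
Qed.

Lemma SpSp_pair g h : isom g -> isom h -> SpSp (pair_of_mx g h).
Proof. by move=> ig ih; apply/(SpSpE n_gt0); rewrite /= !qmat_of_mxK. Qed.

Lemma measurable_closed (A : set X) :
  closed A -> measurable (A : set (borel_qpair R n)).
Proof.
move=> cA; rewrite -[A]setCK; apply: measurableC; apply: sub_sigma_algebra.
exact: closed_openC.
Qed.

Lemma measurable_open (A : set X) :
  open A -> measurable (A : set (borel_qpair R n)).
Proof. by move=> oA; exact: sub_sigma_algebra. Qed.

(** * Points that leave a zero set along a one-parameter group *)

Section OneParameter.
Variables K K' : M.
Hypotheses (sK : skew_nil K) (sK' : skew_nil K').

Definition flow (t : R) : X := pair_of_mx (uexp K t) (uexp K' t).

Lemma flowD s t x : lmul2 (flow s) (lmul2 (flow t) x) = lmul2 (flow (s + t)) x.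
Proof. by rewrite lmul2_pairM !uexpD. Qed.

Lemma flow0 x : lmul2 (flow 0) x = x.
Proof. by rewrite /flow !uexp0 lmul2_pair1. Qed.

Lemma flow_SpSp t : SpSp (flow t).
Proof. by apply: SpSp_pair; exact: uexp_isom. Qed.

Definition tcoords : set (R * X -> R) :=
  fst |` [set b \o snd | b in qcoords].

Lemma polymap_flow : polymap tcoords (fun tx => lmul2 (flow tx.1) tx.2).
Proof.
have pt : polyf tcoords fst by apply: polyf_base; left.
apply: polymap_lmul2.
  have pe (L : M) : mpolyf tcoords (fun tx => uexp L tx.1).
    rewrite /uexp; apply: mpolyfD; first apply: mpolyfD.
    - exact: mpolyf_cst.
    - by apply: mpolyfZ => //; exact: mpolyf_cst.
    - apply: mpolyfZ; last exact: mpolyf_cst.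
      by apply: polyfM; [exact: polyfM | exact: polyf_cst].
  split; rewrite /flow /=.
    by under eq_fun do rewrite qmat_of_mxK; exact: pe.
  by under eq_fun do rewrite qmat_of_mxK; exact: pe.
have [p1 p2] := polymap_id R n.
have cs f : polyf qcoords f -> polyf tcoords (f \o snd).
  apply: polyf_comp => b cb; apply: polyf_base; right; exists b => //.
by split=> i j; [have [a b c d] := p1 i j|have [a b c d] := p2 i j]; split;
  [exact: cs a|exact: cs b|exact: cs c|exact: cs d
  |exact: cs a|exact: cs b|exact: cs c|exact: cs d].
Qed.

Lemma polyf_flow_poly f : polyf qcoords f ->
  exists d : nat, forall x, exists2 p : {poly R}, (size p <= d)%N &
    forall t, f (lmul2 (flow t) x) = p.[t].
Proof.
move=> pf; apply: (polyf_poly_in_fst _ (polyf_polymap pf polymap_flow)).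
move=> _ [->|[b _ <-]].
  exists 2%N => x; exists 'X; first by rewrite size_polyX.
  by move=> t; rewrite hornerX.
exists 1%N => x; exists (b x)%:P; first exact: size_polyC_leq1.
by move=> t; rewrite hornerC.
Qed.

(** The coordinates of the translate are polynomial in the time and the coordinates of [x], all of
    which are bounded on [D]. *)
Lemma flow_box C : exists C', forall t x, `|t| <= 1 -> box C x ->
  box C' (lmul2 (flow t) x).
Proof.
pose D := [set tx : R * X | `|tx.1| <= 1 /\ box C tx.2].
have bD a : exists c, forall tx, D tx -> `|qcoord a (lmul2 (flow tx.1) tx.2)| <= c.
  have pa : polyf qcoords (qcoord a) by apply: polyf_base; exists a.
  apply: (polyf_bounded _ (polyf_polymap pa polymap_flow)).
  move=> _ [->|[_ [b _ <-] <-]]; first by exists 1 => tx [].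
  by exists C => tx [_]; apply.
have [c cP] := choice bD.
exists (\sum_a `|c a|) => t x t1 xb a.
apply: le_trans (cP a (t, x) _) _; first by [].
apply: le_trans (ler_norm _) _; rewrite (bigD1 a) //= lerDl.
exact: sumr_ge0.
Qed.

Variable mu : {measure set (borel_qpair R n) -> \bar R}.
Hypothesis haar : haar_like mu.
Variable f : X -> R.
Hypothesis pf : polyf qcoords f.

Let W C : set X := [set x | [/\ SpSp x, f x = 0, f (lmul2 (flow 1) x) != 0 & box C x]].

Lemma measurable_escape_comp C (h : X -> X) : polymap qcoords h ->
  measurable ([set x | W C (h x)] : set (borel_qpair R n)).
Proof.
move=> ph; have -> : [set x | W C (h x)] =
    [set x | SpSp (h x)] `&` [set x | f (h x) = 0] `&`
    [set x | f (lmul2 (flow 1) (h x)) != 0] `&` [set x | box C (h x)].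
  by apply/seteqP; split=> x /= => [[]|[[[]]]].
do 3?apply: measurableI.
- by apply: measurable_closed; exact: SpSp_closed_comp.
- by apply: measurable_closed; apply: polyf_closed_eq; exact: polyf_polymap pf ph.
- apply: measurable_open; apply: polyf_open_neq.
  exact: polyf_polymap (polyf_lmul2 (flow 1) pf) ph.
- by apply: measurable_closed; exact: box_closed_comp.
Qed.

(** Distinct times in [0, 1], so that infinitely many translates of [W C] stay in one box. [Y C k]
    is written with the inverse flow, which makes measurability immediate; [escape_translate]
    identifies it with the translate. *)
Let s (k : nat) : R := k.+1%:R^-1.
Let Y C k : set X := [set x | W C (lmul2 (flow (- s k)) x)].

(** Along the orbit of [x], [f] is a polynomial [p] that has the root [- s k] whenever [x] lies in
    [Y C k]. *)
Lemma escape_multiplicity C : exists d : nat, forall N x,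
  (\sum_(k < N) (x \in Y C k) <= d)%N.
Proof.
have [d dP] := polyf_flow_poly pf; exists d => N x; have [p pd pE] := dP x.
rewrite (eq_bigr (fun k : 'I_N => if x \in Y C k then 1%N else 0%N)) => [|k _];
  last by case: ifP.
rewrite -big_mkcond sum1_card cardE; set ks := enum _.
have ksY k : k \in ks -> Y C k x by rewrite mem_enum => /set_mem.
have [k0 k0ks|nks] := pickP [pred k | k \in ks]; last first.
  by case E : ks nks => [//|k ?] /(_ k); rewrite inE /= mem_head.
(* A point of [W C] is off the zero set one time unit later, so [p] is nonzero at [1 - s k0]. *)
have p0 : p != 0.
  have [_ _ + _] := ksY _ k0ks; rewrite flowD pE; apply: contra => /eqP ->.
  by rewrite horner0.
have rsP : all (root p) [seq - s (val k) | k <- ks].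
  apply/allP => _ /mapP[k kks ->]; have [_ fk _ _] := ksY _ kks.
  by apply/rootP; rewrite -pE.
have := max_poly_roots p0 rsP; rewrite map_inj_uniq ?enum_uniq ?size_map.
  by move=> /(_ isT) /ltnW /leq_trans; apply.
by move=> k l /oppr_inj /invr_inj /eqP; rewrite eqr_nat eqSS => /eqP /val_inj.
Qed.

Lemma escape_translate C k :
  lmul2 (flow (s k)) @` W C = Y C k.
Proof.
apply/seteqP; split=> [_ [x Wx <-]|x Yx]; first by rewrite /Y /= flowD addNr flow0.
by exists (lmul2 (flow (- s k)) x) => //; rewrite flowD addrN flow0.
Qed.

(** Any [N] translates have equal measure, lie in one box of finite measure and cover each point at
    most [d] times; hence [N] times the measure of [W C] stays bounded as [N] grows. *)
Lemma escape_box_null C : mu (W C) = 0%E.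
Proof.
have [_ finK inv] := haar.
have mW : measurable (W C : set (borel_qpair R n)).
  exact: (measurable_escape_comp C (polymap_id R n)).
have mY k : measurable (Y C k : set (borel_qpair R n)).
  apply: (@measurable_escape_comp C (fun x => lmul2 (flow (- s k)) x)).
  by apply: polymap_lmul2; [exact: polymap_cst | exact: polymap_id].
have muY k : mu (Y C k) = mu (W C).
  by rewrite -escape_translate; apply: inv => //; [exact: flow_SpSp|by move=> x []].
have [C' C'P] := flow_box C.
have s1 k : `|s k| <= 1.
  by rewrite /s ger0_norm ?invr_ge0// invf_le1 // ler1n.
have YB k : Y C k `<=` box C'.
  move=> x; rewrite -escape_translate => -[y [_ _ _ yb] <-].
  by apply: C'P.
have mB : measurable (box C' : set (borel_qpair R n)).
  exact: (measurable_closed (@box_closed_comp R n C' _ (polymap_id R n))).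
have muB := finK _ (@box_compact R n C').
have [d dP] := escape_multiplicity C.
have fB : mu (box C') \is a fin_num by rewrite ge0_fin_numE.
have fW : mu (W C) \is a fin_num.
  rewrite ge0_fin_numE // -(muY 0%N); apply: le_lt_trans muB.
  by apply: le_measure; rewrite ?inE //; exact: YB.
have key N : (N%:R%:E * mu (W C) <= d%:R%:E * mu (box C'))%E.
  apply: le_trans (sum_measure_le mu mY mB YB (dP N)).
  rewrite (eq_bigr (fun=> mu (W C))) => [|k _]; last exact: muY.
  by rewrite -(fineK fW) sumEFin sumr_const card_ord -EFinM mulr_natl.
move: key; rewrite -(fineK fB) -(fineK fW) => key.
have r0 : 0 <= fine (mu (W C)) by exact: fine_ge0.
have B0 : 0 <= fine (mu (box C')) by exact: fine_ge0.
congr EFin; apply/eqP; rewrite eq_le r0 andbT leNgt; apply/negP => rpos.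
set r := fine (mu (W C)) in key rpos; set b := fine _ in key B0.
have := key (Num.Def.archi_bound (d%:R * b / r)).
rewrite -!EFinM lee_fin leNgt => /negP; apply.
rewrite -ltr_pdivrMr //; apply: archi_boundP.
by rewrite divr_ge0 ?mulr_ge0 // ltW.
Qed.

Lemma escape_null :
  mu.-negligible ([set x | [/\ SpSp x, f x = 0 & f (lmul2 (flow 1) x) != 0]]
    : set (borel_qpair R n)).
Proof.
apply: (@negligibleS _ (borel_qpair R n) R mu (\bigcup_k W k%:R)).
  move=> x [h1 h2 h3]; have : setT x by []; rewrite -(@bigcup_box R n) => -[k _ xk].
  by exists k.
apply: negligible_bigcup => k; apply/negligibleP; last exact: escape_box_null.
exact: (measurable_escape_comp k%:R (polymap_id R n)).
Qed.

End OneParameter.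

(** * From one-parameter groups to products of unipotents *)

Inductive unip2 : M -> M -> Prop :=
| unip21 : unip2 1%:M 1%:M
| unip2S K K' g h : skew_nil K -> skew_nil K' -> unip2 g h ->
    unip2 (uexp K 1 *m g) (uexp K' 1 *m h).

Lemma skew_nil0 : skew_nil (0 : M).
Proof.
split; first by rewrite mulmx0.
have -> : (0 : M)^h = 0 by apply/matrixP => i j; rewrite !mxE qconj0.
by rewrite mul0mx mulmx0 oppr0.
Qed.

Lemma uexp0l : uexp (0 : M) 1 = 1%:M.
Proof. by rewrite /uexp mulmx0 !scaler0 !addr0. Qed.

(** Factor the pair as [(g, 1)(1, h)], with exp(0) = 1 in the idle component. *)
Lemma unip_unip2 g h : unip g -> unip h -> unip2 g h.
Proof.
move=> ug uh; elim: ug => [|K g' sK _ IH].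
  elim: uh => [|K h' sK _ IH]; first exact: unip21.
  rewrite -[1%:M]mul1mx -{1}uexp0l; apply: unip2S => //; exact: skew_nil0.
by rewrite -[h]mul1mx -uexp0l; apply: unip2S => //; exact: skew_nil0.
Qed.

Section ZeroSets.
Variable mu : {measure set (borel_qpair R n) -> \bar R}.
Hypothesis haar : haar_like mu.

(** Induction for all [f] at once. Either the outermost factor alone moves [x] off the zero set of
    [f], or [x] is a zero of [f] translated by that factor and the remaining product moves it off
    that zero set. *)
Lemma unip2_escape_null g h : unip2 g h -> forall f, polyf qcoords f ->
  mu.-negligible ([set x | [/\ SpSp x, f x = 0 & f (lmul2 (pair_of_mx g h) x) != 0]]
    : set (borel_qpair R n)).
Proof.
elim=> [f pf|K K' g' h' sK sK' _ IH f pf].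
  apply: negligibleS (negligible_set0 mu) => x [_ fx].
  by rewrite lmul2_pair1 fx eqxx.
have pf1 := polyf_lmul2 (flow K K' 1) pf.
apply: negligibleS (negligibleU (escape_null sK sK' haar pf) (IH _ pf1)).
move=> x [sx fx]; rewrite -lmul2_pairM => fgx.
by have [e|e] := eqVneq (f (lmul2 (flow K K' 1) x)) 0; [right|left].
Qed.

Lemma polyf_zeros_null f : polyf qcoords f ->
  (forall x, SpSp x -> exists g h,
     [/\ unip g, unip h & f (lmul2 (pair_of_mx g h) x) != 0]) ->
  mu.-negligible ([set x | SpSp x /\ f x = 0] : set (borel_qpair R n)).
Proof.
move=> pf esc.
apply: (@negligibleS _ (borel_qpair R n) R mu
  (\bigcup_k [set x | [/\ SpSp x, f x = 0 & box k%:R x]])).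
  move=> x [h1 h2]; have : setT x by []; rewrite -(@bigcup_box R n) => -[k _ xk].
  by exists k.
apply: negligible_bigcup => k.
have cZ : compact [set x : X | [/\ SpSp x, f x = 0 & box k%:R x]].
  have -> : [set x : X | [/\ SpSp x, f x = 0 & box k%:R x]] =
      box k%:R `&` ([set x | SpSp x] `&` [set x | f x = 0]).
    by apply/seteqP; split=> x /= => [[]|[? []]].
  apply: compact_closedI; first exact: box_compact.
  apply: closedI; last exact: polyf_closed_eq.
  exact: (SpSp_closed_comp n_gt0 (polymap_id R n)).
have : cover_compact [set x : X | [/\ SpSp x, f x = 0 & box k%:R x]].
  by rewrite -compact_cover.
(* These open sets cover the compact piece of the zero set, so finitely many pairs of unipotents
   suffice for it. *)
pose F (gh : M * M) := [set x : X | f (lmul2 (pair_of_mx gh.1 gh.2) x) != 0].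
move=> /(_ (M * M)%type [set gh | unip gh.1 /\ unip gh.2] F).
case=> [gh _|x [sx _ _]|D' D'P D'c].
- by apply: polyf_open_neq; exact: polyf_lmul2.
- by have [g [h [ug uh fx]]] := esc x sx; exists (g, h).
apply: (@negligibleS _ (borel_qpair R n) R mu (\big[setU/set0]_(gh <- finmap.enum_fset D')
    [set x : X | [/\ SpSp x, f x = 0 & F gh x]])).
  rewrite -bigcup_fset => x xZ; have [gh ghD Fx] := D'c x xZ.
  by exists gh => //; case: xZ.
rewrite big_seq; elim/big_ind: _ => [|A B|gh ghD].
- exact: negligible_set0.
- exact: negligibleU.
- have /set_mem[ug uh] := D'P gh ghD.
  by apply: unip2_escape_null => //; exact: unip_unip2.
Qed.

End ZeroSets.
End Nullity.

(** The set of (representatives in Sp(n,1) x Sp(n,1) of) strongly doubly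
    reversible pairs in PSp(n,1) has Haar measure zero. *)
Theorem theorem4p1 (R : realType) (n : nat) (hn : (1 <= n)%N) :
  haar_null
    [set p : qpair R n | SpSp p /\ psp_strongly_doubly_reversible p.1 p.2].
Proof.
move=> mu haar.
pose f (p : qpair R n) : R := trace_defect (mx_of_qmat p.1) (mx_of_qmat p.2).
have pf : polyf (@qcoords R n) f.
  have [p1 p2] := polymap_id R n.
  (* The words are written with the ring product of matrices, so [mpolyfM] is restated for it. *)
  have pM (F G : qpair R n -> 'M[quat R]_(n.+1)) :
      mpolyf (@qcoords R n) F -> mpolyf (@qcoords R n) G ->
      mpolyf (@qcoords R n) (fun x => F x * G x) by exact: mpolyfM.
  have pC F := fun pF => @pM _ F (@pM F F pF pF).
  have [c1 c2] := (pC _ p1 p1, pC _ p2 p2).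
  apply: polyfB; apply: mpolyf_tr.
    exact: pM (pM _ _ (pM _ _ c1 c2) p1) p2.
  exact: pM (pM _ _ (pM _ _ c1 p2) p1) c2.
apply: negligibleS (polyf_zeros_null hn haar pf _) => [p [sp rp]|p].
  by split=> //; exact: reversible_trace_defect.
move=> /(SpSpE hn)[iA iB].
have [g [h [ug uh gh]]] := unip_trace_defect_neq0 hn iA iB.
exists g, h; split; [exact: ug|exact: uh|]; move: gh.
by rewrite /f /= !mx_of_qmatM !qmat_of_mxK.
Qed.
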